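(* Let $Q$ be a finite quiver and $\Phi\in\widetilde{\mathbb CQ}_{cyc}$ an analytic potential. If $\Phi$ is $\widetilde J$-finite then $\Phi$ is finitely determined. More precisely, if $\widetilde J(Q,\Phi)\supseteq\widetilde{\mathfrak m}^r$ for some integer $r\ge0$, then $\Phi$ is $(r+1)$-determined.
   Context: $l=\mathbb CQ_0$; $\widehat{\mathbb CQ}$ is the path algebra of $Q$ completed at the arrow ideal, with elements $\sum_wa_ww$ ($w$ paths, $|w|$ length); $\widetilde{\mathbb CQ}$ is the subalgebra of analytic series: those for which there is $C>0$ with $|a_w|\le C^{|w|}$ for all $w$ with $|w|$ sufficiently large. $\widetilde{\mathfrak m}\subset\widetilde{\mathbb CQ}$ is the ideal of series without terms of length $0$. $\widetilde{\mathbb CQ}_{cyc}$ is the image of $\widetilde{\mathbb CQ}$ in $\widehat{\mathbb CQ}/[\widehat{\mathbb CQ},\widehat{\mathbb CQ}]^{cl}$ (quotient by the adic closure of the commutator space); its elements are analytic potentials. For $a\in Q_1$, $D_a$ sends a cyclic path $c$ to $\sum_{c=uav}vu$. The analytic Jacobi ideal is $\widetilde J(Q,\Phi)=\{\sum_{a\in Q_1}\sum_{u,v}A^{(a)}_{u,v}\,u\,(D_a\Phi)\,v\}$, where $u,v$ run over paths and the coefficients satisfy $|A^{(a)}_{u,v}|\le C^{|u|+|v|}$ for some $C>0$ and $|u|+|v|$ large. $\Phi$ is $\widetilde J$-finite if $\widetilde\Lambda(Q,\Phi)=\widetilde{\mathbb CQ}/\widetilde J(Q,\Phi)$ is finite dimensional.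 Two analytic potentials are analytically right equivalent if they lie in the same orbit of the group $\mathrm{Aut}_l(\widetilde{\mathbb CQ})$ of analytic $l$-algebra automorphisms. The $r$-jet $\Phi^{(r)}$ is the image of $\Phi$ in $\mathcal J^r/[\mathcal J^r,\mathcal J^r]$, $\mathcal J^r=\widetilde{\mathbb CQ}/\widetilde{\mathfrak m}^{r+1}$. $\Phi$ is $r$-determined if for every $\Psi\in\widetilde{\mathbb CQ}_{cyc}$ with $\Psi^{(r)}=\Phi^{(r)}$, $\Psi$ is analytically right equivalent to $\Phi$; it is finitely determined if it is $r$-determined for some $r\ge0$. *)

(* Defs.v *)
From HB Require Import structures.
From mathcomp Require Import all_boot all_order all_algebra.
From mathcomp Require Import boolp classical_sets functions cardinality fsbigop.
From mathcomp Require Import reals.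
From mathcomp Require Import complex.

Set Implicit Arguments.
Unset Strict Implicit.
Unset Printing Implicit Defensive.

Import Order.TTheory GRing.Theory Num.Theory.

Local Open Scope classical_set_scope.
Local Open Scope complex_scope.
Local Open Scope ring_scope.

Record quiver := Quiver {
  vertex : finType;
  arrow : finType;
  src : arrow -> vertex;
  tgt : arrow -> vertex }.

Section Paths.
Variable Q : quiver.
Implicit Types (x : vertex Q) (a : arrow Q) (w : seq (arrow Q)).

(* Paths are read from left to right: in [a :: w] the arrow [a] comes first.
   The other convention amounts to replacing Q by its opposite. *)
Fixpoint is_path x w : bool :=
  if w is a :: w' then (src a == x) && is_path (tgt a) w' else true.

Definition endpoint x w : vertex Q := last x (map (@tgt Q) w).

(* The starting vertex is recorded because of the paths of length 0. *)
Record qpath := QPath {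
  qpath_val : vertex Q * seq (arrow Q);
  _ : is_path qpath_val.1 qpath_val.2 }.

HB.instance Definition _ := [isSub for qpath_val].
HB.instance Definition _ := [Countable of qpath by <:].

Definition pstart (p : qpath) : vertex Q := (val p).1.
Definition parrows (p : qpath) : seq (arrow Q) := (val p).2.
Definition pend (p : qpath) : vertex Q := endpoint (pstart p) (parrows p).
Definition plength (p : qpath) : nat := size (parrows p).

Lemma is_path_cat x w1 w2 :
  is_path x (w1 ++ w2) = is_path x w1 && is_path (endpoint x w1) w2.
Proof. by elim: w1 x => //= a w IH x; rewrite IH andbA. Qed.

Lemma endpoint_cat x w1 w2 :
  endpoint x (w1 ++ w2) = endpoint (endpoint x w1) w2.
Proof. by rewrite /endpoint map_cat last_cat. Qed.

Definition trivial_path x : qpath := @QPath (x, [::]) isT.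

End Paths.

Section CommutatorsAndIdealPowers.
Variable A : pzRingType.

Definition commutators : set A :=
  [set f | exists s : seq (A * A),
     f = \sum_(gh <- s) (gh.1 * gh.2 - gh.2 * gh.1)].

Fixpoint ideal_pow (I : set A) (n : nat) : set A :=
  if n is n'.+1 then
    [set f | exists2 s : seq (A * A),
       (forall gh, gh \in s -> I gh.1 /\ ideal_pow I n' gh.2) &
       f = \sum_(gh <- s) gh.1 * gh.2]
  else [set: A].

Lemma commutatorsB f g : commutators f -> commutators g -> commutators (f - g).
Proof.
move=> [s ->] [t ->]; exists (s ++ [seq (gh.2, gh.1) | gh <- t]).
rewrite big_cat big_map /= -sumrN; congr (_ + _).
by apply: eq_bigr => gh _; rewrite opprB.
Qed.

Lemma commutators0 : commutators 0.
Proof. by exists [::]; rewrite big_nil. Qed.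

Lemma ideal_pow0 I n : ideal_pow I n 0.
Proof. by case: n => //= n; exists [::] => //; rewrite big_nil. Qed.

Lemma ideal_powB (I : set A) n f g : (forall h, I h -> I (- h)) ->
  ideal_pow I n f -> ideal_pow I n g -> ideal_pow I n (f - g).
Proof.
move=> IN; case: n => //= n [s sI ->] [t tI ->].
exists (s ++ [seq (- gh.1, gh.2) | gh <- t]).
  move=> gh; rewrite mem_cat => /orP[/sI//|/mapP[kl /tI[? ?] ->]] /=.
  by split=> //; apply: IN.
rewrite big_cat big_map /= -sumrN; congr (_ + _).
by apply: eq_bigr => gh _; rewrite mulNr.
Qed.

End CommutatorsAndIdealPowers.

Section FormalSeries.
Variables (R : realType) (Q : quiver).

(* R[i] is the field of complex numbers. A formal series is the family of its
   coefficients; the product below is the concatenation product. *)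
Definition series : Type := qpath Q -> R[i].

HB.instance Definition _ := GRing.Zmodule.copy series (qpath Q -> R[i]).

Implicit Types f g h : series.

Definition series_scale (c : R[i]) f : series := fun p => c * f p.

Fact series_scaleA c d f :
  series_scale c (series_scale d f) = series_scale (c * d) f.
Proof. by apply/funext => p; rewrite /series_scale mulrA. Qed.

Fact series_scale1 : left_id 1 series_scale.
Proof. by move=> f; apply/funext => p; rewrite /series_scale mul1r. Qed.

Fact series_scaleDr : right_distributive series_scale +%R.
Proof.
by move=> c f g; apply/funext => p; rewrite /series_scale -[RHS]mulrDr.
Qed.

Fact series_scaleDl f : {morph series_scale^~ f : c d / c + d}.
Proof. by move=> c d; apply/funext => p; rewrite /series_scale mulrDl. Qed.

HB.instance Definition _ := GRing.Zmodule_isLmodule.Build R[i] series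
  series_scaleA series_scale1 series_scaleDr series_scaleDl.

(* Coefficient of the word w read from the vertex x; it is 0 if that word is
   not a path. *)
Definition coef f (x : vertex Q) (w : seq (arrow Q)) : R[i] :=
  if insub (x, w) is Some p then f p else 0.

Definition series_one : series := fun p => (plength p == 0%N)%:R.

Definition series_mul f g : series := fun p =>
  \sum_(i < (plength p).+1)
     coef f (pstart p) (take i (parrows p)) *
     coef g (endpoint (pstart p) (take i (parrows p))) (drop i (parrows p)).

Lemma coefP f (p : qpath Q) : coef f (pstart p) (parrows p) = f p.
Proof. by rewrite /coef /pstart /parrows -surjective_pairing valK. Qed.

Lemma coef_path f x w (xw : is_path x w) : coef f x w = f (@QPath Q (x, w) xw).
Proof. by rewrite /coef insubT. Qed.

Lemma coef_out f x w : ~~ is_path x w -> coef f x w = 0.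
Proof. by move=> xw; rewrite /coef insubF //=; apply: negPf. Qed.

Lemma coefD f g x w : coef (f + g) x w = coef f x w + coef g x w.
Proof. by rewrite /coef; case: insub => //=; rewrite addr0. Qed.

Lemma coef_one x w : coef series_one x w = (w == [::])%:R.
Proof.
case: (boolP (is_path x w)) => [xw|nxw].
  by rewrite (coef_path _ xw) /series_one /plength /parrows /= size_eq0.
by rewrite coef_out //; case: w nxw.
Qed.

Lemma coef_mul f g x w : coef (series_mul f g) x w =
  \sum_(i < (size w).+1)
     coef f x (take i w) * coef g (endpoint x (take i w)) (drop i w).
Proof.
case: (boolP (is_path x w)) => [xw|nxw]; first by rewrite (coef_path _ xw).
rewrite coef_out // big1 // => i _.
move: nxw; rewrite -{1}(cat_take_drop i w) is_path_cat negb_and.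
by case/orP => /coef_out ->; rewrite ?mul0r ?mulr0.
Qed.

Lemma series_ext f g : (forall x w, coef f x w = coef g x w) -> f = g.
Proof. by move=> fg; apply/funext => p; rewrite -!coefP fg. Qed.

Lemma coef_mul_nat f g x w : coef (series_mul f g) x w =
  \sum_(0 <= i < (size w).+1)
     coef f x (take i w) * coef g (endpoint x (take i w)) (drop i w).
Proof. by rewrite coef_mul big_mkord. Qed.

Fact series_mulA : associative series_mul.
Proof.
move=> f g h; apply: series_ext => x w; rewrite !coef_mul.
pose F (i j : nat) := coef f x (take i w) *
  coef g (endpoint x (take i w)) (take (j - i) (drop i w)) *
  coef h (endpoint x (take j w)) (drop j w).
have -> : \sum_(i < (size w).+1) coef f x (take i w) *
    coef (series_mul g h) (endpoint x (take i w)) (drop i w) =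
    \sum_(i < (size w).+1) \sum_(j < (size w).+1 | (i <= j)%N) F i j.
  apply: eq_bigr => i _; rewrite coef_mul mulr_sumr.
  rewrite -(big_mkord xpredT (fun k => coef f x (take i w) * (
    coef g (endpoint x (take i w)) (take k (drop i w)) *
    coef h (endpoint (endpoint x (take i w)) (take k (drop i w)))
      (drop k (drop i w))))).
  have iw : (i <= size w)%N by rewrite -ltnS.
  rewrite -(big_mkord (leq i) (F i)).
  rewrite [RHS](big_cat_nat (n := i)) //=; last by rewrite ltnW.
  rewrite [X in _ = X + _]big_nat_cond [X in _ = X + _]big_pred0
    ?add0r; last first.
    by move=> j /=; case: (leqP i j); rewrite ?andbF.
  have := big_addn 0 (size w).+1 i (leq i) (F i); rewrite add0n => ->.
  rewrite size_drop subSn //.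
  rewrite big_nat_cond [RHS]big_nat_cond; apply: eq_big => [k|k].
    by rewrite leq_addl.
  move=> _; rewrite /F addnK mulrA -endpoint_cat drop_drop.
  congr (_ * coef h (endpoint x _) _).
  by rewrite [in RHS]addnC takeD.
rewrite (exchange_big_dep xpredT) //=; apply: eq_bigr => j _.
have jw : (j <= size w)%N by rewrite -ltnS.
rewrite coef_mul mulr_suml size_takel //.
rewrite -(big_mkord (fun i => (i <= j)%N) (F^~ j)).
rewrite -(big_mkord xpredT (fun i => coef f x (take i (take j w)) *
   coef g (endpoint x (take i (take j w))) (drop i (take j w)) *
   coef h (endpoint x (take j w)) (drop j w))).
rewrite (big_cat_nat (n := j.+1)) //=.
rewrite [X in _ + X]big_nat_cond [X in _ + X]big_pred0 ?addr0; last first.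
  by move=> i /=; case: (leqP i j); rewrite ?andbF // ltnNge => ->.
rewrite big_nat_cond [RHS]big_nat_cond; apply: eq_big => [i|i].
  by rewrite /= ltnS; case: (leqP i j).
move=> /andP[/= ij _]; rewrite ltnS in ij.
by rewrite /F take_takel // take_drop subnK.
Qed.

Fact series_mul1 : left_id series_one series_mul.
Proof.
move=> f; apply: series_ext => x w; rewrite coef_mul big_ord_recl /=.
rewrite take0 drop0 coef_one eqxx mul1r big1 ?addr0 // => i _.
by rewrite coef_one; case: w i => [[]//|a w i]; rewrite mul0r.
Qed.

Fact series_mulr1 : right_id series_one series_mul.
Proof.
move=> f; apply: series_ext => x w; rewrite coef_mul big_ord_recr /=.
rewrite take_size drop_size coef_one eqxx mulr1 big1 ?add0r // => i _.
rewrite coef_one -size_eq0 size_drop subn_eq0 leqNgt.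
by rewrite ltn_ord mulr0.
Qed.

Fact series_mulDl : left_distributive series_mul +%R.
Proof.
move=> f g h; apply: series_ext => x w; rewrite coefD !coef_mul -big_split /=.
by apply: eq_bigr => i _; rewrite coefD mulrDl.
Qed.

Fact series_mulDr : right_distributive series_mul +%R.
Proof.
move=> f g h; apply: series_ext => x w; rewrite coefD !coef_mul -big_split /=.
by apply: eq_bigr => i _; rewrite coefD mulrDr.
Qed.

(* [series] is not declared as an [algType]: that structure requires 1 != 0,
   which fails for the empty quiver. *)
HB.instance Definition _ := GRing.Zmodule_isPzRing.Build series
  series_mulA series_mul1 series_mulr1 series_mulDl series_mulDr.

Lemma series_oneE p : (1 : series) p = (plength p == 0%N)%:R.
Proof. by []. Qed.

Lemma series_mulE f g p : (f * g) p =
  \sum_(i < (plength p).+1)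
     coef f (pstart p) (take i (parrows p)) *
     coef g (endpoint (pstart p) (take i (parrows p))) (drop i (parrows p)).
Proof. by []. Qed.

Lemma series_scaleE (c : R[i]) f p : (c *: f) p = c * f p.
Proof. by []. Qed.

Definition monomial (u : qpath Q) : series := fun p => (p == u)%:R.

Definition formal_max : set series :=
  [set f | forall p, plength p = 0%N -> f p = 0].

Definition adic_closure (S : set series) : set series :=
  [set f | forall n, exists2 g, S g & ideal_pow formal_max n (f - g)].

(* Coefficientwise form of D_a c = \sum_(c = u a v) v u: the coefficient of a
   path p in D_a f is the sum, over the factorizations p = v u, of the
   coefficient of u a v in f. The test expresses that u a v is a closed path. *)
Definition cyclic_derivative (a : arrow Q) f : series := fun p =>
  if (pstart p == tgt a) && (pend p == src a) then
    \sum_(i < (plength p).+1)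
       let v := take i (parrows p) in
       let u := drop i (parrows p) in
       coef f (endpoint (pstart p) v) (u ++ a :: v)
  else 0.

Definition is_analytic f : Prop :=
  exists C : R, 0 < C /\ exists N : nat,
    forall p, (N <= plength p)%N -> `|f p| <= (C ^+ plength p)%:C.

Definition analytic_pred : {pred series} := fun f => `[< is_analytic f >].

End FormalSeries.

Section Analytic.
Variables (R : realType) (Q : quiver).

Lemma coef_mul_neq0 (f g : series R Q) (x : vertex Q) w :
  coef (f * g) x w != 0 ->
  exists2 i, (i <= size w)%N &
    coef f x (take i w) != 0 /\ coef g (endpoint x (take i w)) (drop i w) != 0.
Proof.
rewrite [coef _ _ _]coef_mul => fg; apply: contrapT => none; move/eqP: fg.
apply.
apply: big1 => i _; apply/eqP; apply: contraT; rewrite mulf_eq0 negb_or.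
by move=> /andP fgi; case: none; exists i => //; rewrite -ltnS.
Qed.

Lemma coef_monomial_neq0 (u : qpath Q) x w :
  coef (monomial R u) x w != 0 -> val u = (x, w).
Proof.
case: (boolP (is_path x w)) => xw; last by rewrite coef_out // eqxx.
rewrite (coef_path _ xw) /monomial; case: (_ =P u) => [<- //|_].
by rewrite eqxx.
Qed.

(* Only finitely many pairs of paths (u, v) contribute to the coefficient of a
   given path in an infinite sum of terms u h v. *)
Lemma monomial_mul_support (h : series R Q) (p : qpath Q) :
  finite_set [set uv : qpath Q * qpath Q |
    (monomial R uv.1 * h * monomial R uv.2) p != 0].
Proof.
pose w := parrows p; pose x := pstart p; pose I := iota 0 (size w).+1.
pose us : seq (qpath Q) :=
  pmap insub [seq (x, take j (take i w)) | i <- I, j <- I].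
pose vs : seq (qpath Q) :=
  pmap insub [seq (endpoint x (take i w), drop i w) | i <- I].
apply: (@sub_finite_set _ _ [set` [seq (u, v) | u <- us, v <- vs]]); last first.
  exact: finite_seq.
move=> [u v] /=; rewrite -coefP.
move=> /coef_mul_neq0[i iw [/coef_mul_neq0[j ji []]]].
move=> /coef_monomial_neq0 uE _ /coef_monomial_neq0 vE.
have iI : i \in I by rewrite mem_iota.
have jI : j \in I.
  by rewrite mem_iota /= add0n ltnS (leq_trans ji) // size_take_min geq_minr.
apply/allpairsP; exists (u, v); split => //=.
  rewrite mem_pmap_sub; apply/allpairsP; exists (i, j); split => //.
by rewrite mem_pmap_sub; apply/mapP; exists i.
Qed.

Lemma normc_real (z : R[i]) : exists2 r : R, 0 <= r & `|z| = r%:C.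
Proof.
by eexists; last exact: normc_def; exact: sqrtr_ge0.
Qed.

Lemma short_bounded (f : series R Q) N : exists2 M : R,
  0 <= M & forall p, (plength p < N)%N -> `|f p| <= M%:C.
Proof.
elim: N => [|N [M M0 fM]]; first by exists 0.
pose B := \sum_(x : vertex Q) \sum_(t : N.-tuple (arrow Q)) `|coef f x t|.
have [r r0 Br] := normc_real B.
exists (M + r) => [|p]; first exact: addr_ge0.
rewrite ltnS leq_eqVlt rmorphD /= => /predU1P[pN|/fM pM]; last first.
  by apply: le_trans pM _; rewrite lerDl lecR.
have : `|f p| <= B.
  rewrite -coefP /B (bigD1 (pstart p)) //=.
  rewrite (bigD1 (Tuple (introT eqP pN))) //= -addrA lerDl.
  by rewrite addr_ge0 // ?sumr_ge0 // => x _; rewrite sumr_ge0.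
move=> /le_trans; apply; apply: le_trans (real_ler_norm _) _.
  by rewrite ger0_real // sumr_ge0 // => x _; rewrite sumr_ge0.
by rewrite Br lerDr lecR.
Qed.

Lemma analyticP (f : series R Q) : is_analytic f <->
  exists2 MC : R * R, 1 <= MC.1 /\ 1 <= MC.2 &
    forall p, `|f p| <= (MC.1 * MC.2 ^+ plength p)%:C.
Proof.
split=> [[C [C0 [N fC]]]|[[M C] /= [M1 C1] fMC]].
  have [M M0 fM] := short_bounded f N.
  exists (1 + M, 1 + C) => /=; first by rewrite !lerDl M0 ltW.
  have C1 n : 1 <= (1 + C) ^+ n by rewrite exprn_ege1 // lerDl ltW.
  have M1 : 1 <= 1 + M by rewrite lerDl.
  move=> p; case: (ltnP (plength p) N) => [/fM|/fC] /le_trans; apply.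
    rewrite lecR; apply: le_trans (_ : 1 + M <= _); first by rewrite lerDr.
    by rewrite ler_peMr // (le_trans _ M1).
  rewrite lecR; apply: le_trans (_ : (1 + C) ^+ plength p <= _).
    by rewrite lerXn2r ?nnegrE ?addr_ge0 ?lerDr ?ltW.
  by rewrite ler_peMl // (le_trans _ (C1 _)).
exists (M * C); split.
  by rewrite mulr_gt0 // (lt_le_trans _ M1, lt_le_trans _ C1).
exists 1%N => p p1; apply: le_trans (fMC p) _; rewrite lecR exprMn.
have C0 : 0 <= C by rewrite (le_trans _ C1).
rewrite ler_wpM2r ?exprn_ge0 //.
case: (plength p) p1 => // n _.
by rewrite exprS ler_peMr ?exprn_ege1 // (le_trans _ M1).
Qed.

Lemma analytic_common (f g : series R Q) : is_analytic f -> is_analytic g ->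
  exists2 MC : R * R, 1 <= MC.1 /\ 1 <= MC.2 &
    forall p, `|f p| <= (MC.1 * MC.2 ^+ plength p)%:C /\
              `|g p| <= (MC.1 * MC.2 ^+ plength p)%:C.
Proof.
move=> /analyticP[[M C] /= [M1 C1] fb] /analyticP[[N D] /= [N1 D1] gb].
have M0 : 0 <= M := le_trans ler01 M1.
have N0 : 0 <= N := le_trans ler01 N1.
have C0 : 0 <= C := le_trans ler01 C1.
have D0 : 0 <= D := le_trans ler01 D1.
exists (M + N, C + D) => /=.
  by rewrite (le_trans M1) ?lerDl // (le_trans C1) ?lerDl.
move=> p; split; [apply: le_trans (fb p) _|apply: le_trans (gb p) _];
  by rewrite lecR ler_pM ?exprn_ge0 ?lerDl ?lerDr // lerXn2r ?nnegrE
     ?addr_ge0 ?lerDl ?lerDr.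
Qed.

Lemma analytic_bound (f : series R Q) (M C : R) : 0 <= M -> 0 <= C ->
  (forall p, `|f p| <= (M * C ^+ plength p)%:C) -> is_analytic f.
Proof.
move=> M0 C0 fb; apply/analyticP; exists (1 + M, 1 + C) => /=.
  by rewrite !lerDl.
move=> p; apply: le_trans (fb p) _.
by rewrite lecR ler_pM ?exprn_ge0 ?lerDr // lerXn2r ?nnegrE ?addr_ge0 ?lerDr.
Qed.

Lemma coef_bound (f : series R Q) (M C : R) x w : 0 <= M -> 0 <= C ->
  (forall p, `|f p| <= (M * C ^+ plength p)%:C) ->
  `|coef f x w| <= (M * C ^+ size w)%:C.
Proof.
move=> M0 C0 fb; case: (boolP (is_path x w)) => xw.
  by rewrite (coef_path _ xw); apply: fb.
by rewrite coef_out // normr0 (lecR 0) mulr_ge0 ?exprn_ge0.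
Qed.

Fact analytic_subring_closed : subring_closed (@analytic_pred R Q).
Proof.
split=> [|f g /asboolP fa /asboolP ga|f g /asboolP fa /asboolP ga];
  apply/asboolP.
- apply: (@analytic_bound _ 1 1) => // p; rewrite expr1n mulr1.
  by rewrite series_oneE; case: eqP; rewrite ?normr1 ?normr0 ?ler01.
- have [[M C] /= [M1 C1] fgb] := analytic_common fa ga.
  apply: (@analytic_bound _ (M + M) C); rewrite ?addr_ge0 // ?(le_trans ler01) //.
  move=> p; have [fp gp] := fgb p; rewrite mulrDl rmorphD.
  exact: le_trans (ler_normB _ _) (lerD fp gp).
- have [[M C] /= [M1 C1] fgb] := analytic_common fa ga.
  have M0 : 0 <= M := le_trans ler01 M1.
  have C0 : 0 <= C := le_trans ler01 C1.
  have fb p : `|f p| <= (M * C ^+ plength p)%:C by case: (fgb p).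
  have gb p : `|g p| <= (M * C ^+ plength p)%:C by case: (fgb p).
  apply: (@analytic_bound _ (M ^+ 2) (2 * C)); rewrite ?exprn_ge0 ?mulr_ge0 //.
  move=> p; rewrite series_mulE.
  apply: le_trans (ler_norm_sum _ _ _) _.
  have -> : (M ^+ 2 * (2 * C) ^+ plength p) =
      (M ^+ 2 * C ^+ plength p) * 2 ^+ plength p.
    by rewrite exprMn mulrA mulrAC.
  apply: le_trans (_ : ((M ^+ 2 * C ^+ plength p) *+ (plength p).+1)%:C <= _).
    rewrite rmorphMn -[X in _ *+ X]card_ord -sumr_const.
    apply: ler_sum => i _; rewrite normrM.
    have ip : (i <= size (parrows p))%N by rewrite -ltnS.
    have -> : M ^+ 2 * C ^+ plength p =
        (M * C ^+ size (take i (parrows p))) *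
        (M * C ^+ size (drop i (parrows p))).
      rewrite mulrACA -expr2 -exprD size_takel // size_drop subnKC //.
    by rewrite rmorphM ler_pM ?normr_ge0 // coef_bound.
  rewrite lecR -[X in X <= _]mulr_natr ler_wpM2l ?mulr_ge0 ?exprn_ge0 //.
  by rewrite -natrX ler_nat ltn_expl.
Qed.

Fact analytic_scale_closed : GRing.scaler_closed (@analytic_pred R Q).
Proof.
move=> c f /asboolP/analyticP[[M C] /= [M1 C1] fb]; apply/asboolP.
have [r r0 cr] := normc_real c.
apply: (@analytic_bound _ (r * M) C); rewrite ?mulr_ge0 // ?(le_trans ler01) //.
move=> p; rewrite -mulrA rmorphM /= -cr.
rewrite series_scaleE normrM.
by rewrite ler_wpM2l.
Qed.

HB.instance Definition _ := GRing.isSubringClosed.Build (series R Q)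
  (@analytic_pred R Q) analytic_subring_closed.
HB.instance Definition _ := GRing.isScaleClosed.Build R[i] (series R Q)
  (@analytic_pred R Q) analytic_scale_closed.

Record analytic := Analytic {
  analytic_val :> series R Q;
  _ : analytic_val \in @analytic_pred R Q }.

HB.instance Definition _ := [isSub for analytic_val].
HB.instance Definition _ := [Choice of analytic by <:].
HB.instance Definition _ :=
  GRing.SubChoice_isSubPzRing.Build _ _ analytic analytic_subring_closed.
HB.instance Definition _ := [SubZmodule_isSubLmodule of analytic by <:].

Lemma analytic_valB (f g : analytic) :
  analytic_val (f - g) = analytic_val f - analytic_val g.
Proof. exact: (raddfB val). Qed.

Lemma analytic_valN (f : analytic) : analytic_val (- f) = - analytic_val f.
Proof. exact: (raddfN val). Qed.

Fact monomial_analytic (u : qpath Q) : monomial R u \in @analytic_pred R Q.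
Proof.
apply/asboolP; apply: (@analytic_bound _ 1 1) => // p.
by rewrite expr1n mulr1 /monomial; case: eqP; rewrite ?normr1 ?normr0 ?ler01.
Qed.

Definition path_series (u : qpath Q) : analytic :=
  Analytic (monomial_analytic u).

Definition analytic_max : set analytic := [set f | @formal_max R Q f].

Definition cyclic_kernel : {pred analytic} := fun f =>
  `[< adic_closure (@commutators (series R Q)) f >].

Fact cyclic_kernel_zmod_closed : zmod_closed cyclic_kernel.
Proof.
have maxN (h : series R Q) : formal_max h -> formal_max (- h).
  by move=> h0 p /h0 hp; rewrite [LHS](_ : _ = - h p) // hp oppr0.
split=> [|f g /asboolP fc /asboolP gc]; apply/asboolP => n.
  exists 0; first exact: commutators0.
  by rewrite subrr; apply: ideal_pow0.
have [[c cc cn] [d dc dn]] := (fc n, gc n).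
exists (c - d); first exact: commutatorsB.
rewrite analytic_valB.
rewrite [X in ideal_pow _ _ X](_ : _ = (val f - c) - (val g - d)); last first.
  by rewrite !opprD !opprK addrACA.
exact: ideal_powB.
Qed.

HB.instance Definition _ := GRing.isZmodClosed.Build analytic cyclic_kernel
  cyclic_kernel_zmod_closed.

(* The map [analytic -> series / adic_closure [series, series]] has kernel
   [cyclic_kernel]; its image is thus the following quotient. *)
Definition potential : Type := Quotient.quot cyclic_kernel.

HB.instance Definition _ := GRing.Zmodule.on potential.

Definition cyc (f : analytic) : potential :=
  (\pi_(Quotient.quot cyclic_kernel) f)%qT.

Definition representative (Phi : potential) : analytic :=
  repr (Phi : Quotient.quot cyclic_kernel).

Lemma representativeK Phi : cyc (representative Phi) = Phi.
Proof. exact: reprK. Qed.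

Lemma cyc_eq f g : cyc f = cyc g <->
  adic_closure (@commutators (series R Q)) (analytic_val f - analytic_val g).
Proof.
rewrite -analytic_valB; split=> [/eqP|fg]; last apply/eqP.
  by rewrite -Quotient.idealrBE => /asboolP.
by rewrite -Quotient.idealrBE; apply/asboolP.
Qed.


(* Likewise J^r / [J^r, J^r], with J^r = analytic / analytic_max ^ (r + 1), is
   the quotient of [analytic] by commutators + analytic_max ^ (r + 1). *)
Definition jet_kernel (r : nat) : {pred analytic} := fun f =>
  `[< exists2 g, @commutators analytic g &
        ideal_pow analytic_max r.+1 (f - g) >].

Fact jet_kernel_zmod_closed r : zmod_closed (jet_kernel r).
Proof.
have maxN (h : analytic) : analytic_max h -> analytic_max (- h).
  move=> h0 p /h0 hp; rewrite analytic_valN.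
  by rewrite [LHS](_ : _ = - analytic_val h p) // hp oppr0.
split=> [|f g /asboolP[c cc cn] /asboolP[d dc dn]]; apply/asboolP.
  exists 0; first exact: commutators0.
  by rewrite subrr; apply: ideal_pow0.
exists (c - d); first exact: commutatorsB.
rewrite [X in ideal_pow _ _ X](_ : _ = (f - c) - (g - d)); last first.
  by rewrite !opprD !opprK addrACA.
exact: ideal_powB.
Qed.

HB.instance Definition _ r := GRing.isZmodClosed.Build analytic (jet_kernel r)
  (jet_kernel_zmod_closed r).

Definition jet_space (r : nat) : Type := Quotient.quot (jet_kernel r).

HB.instance Definition _ r := GRing.Zmodule.on (jet_space r).

Definition jet (r : nat) (Phi : potential) : jet_space r :=
  (\pi_(Quotient.quot (jet_kernel r)) (representative Phi))%qT.

Lemma jet_eq r Phi Psi : jet r Phi = jet r Psi <->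
  exists2 g, @commutators analytic g &
    ideal_pow analytic_max r.+1 (representative Phi - representative Psi - g).
Proof.
split=> [/eqP|h]; last apply/eqP.
  by rewrite -Quotient.idealrBE => /asboolP.
by rewrite -Quotient.idealrBE; apply/asboolP.
Qed.

(* Linearity makes it enough to require that the trivial paths, which span
   l = C Q_0, are fixed. *)
Definition analytic_automorphism (phi : analytic -> analytic) : Prop :=
  [/\ linear phi, monoid_morphism phi, bijective phi &
      forall x, phi (path_series (trivial_path x)) =
                path_series (trivial_path x)].

(* An automorphism preserves the powers of [analytic_max], hence acts on
   potentials; the class of [phi f] does not depend on the choice of f. *)
Definition right_equivalent (Phi Psi : potential) : Prop :=
  exists2 phi, analytic_automorphism phi &
    cyc (phi (representative Phi)) = Psi.

Definition determined (r : nat) (Phi : potential) : Prop :=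
  forall Psi, jet r Psi = jet r Phi -> right_equivalent Phi Psi.

Definition finitely_determined (Phi : potential) : Prop :=
  exists r, determined r Phi.

(* The infinite sum is taken coefficientwise: by [monomial_mul_support] each
   inner sum has finite support. [cyclic_derivative] vanishes on the closure of
   the commutators, so the representative does not matter. *)
Definition jacobi_ideal (Phi : potential) : set analytic :=
  [set f | exists A : arrow Q -> qpath Q -> qpath Q -> R[i],
     (exists C : R, 0 < C /\ exists N : nat, forall a u v,
        (N <= plength u + plength v)%N ->
        `|A a u v| <= (C ^+ (plength u + plength v))%:C) /\
     forall p, analytic_val f p =
       \sum_(a : arrow Q) \sum_(uv \in [set: qpath Q * qpath Q])
          A a uv.1 uv.2 *
          (monomial R uv.1 * cyclic_derivative a (representative Phi) *
           monomial R uv.2) p].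

Definition jacobi_finite (Phi : potential) : Prop :=
  exists (n : nat) (b : 'I_n -> analytic), forall f,
    exists c : 'I_n -> R[i],
      jacobi_ideal Phi (f - \sum_(i < n) c i *: b i).

End Analytic.

(* Main.v *)
(** Write Theta for the difference of the two potentials. Modulo commutators,
    Theta is a sum of products g_a D_a(Phi), that is, the value at Phi of the
    derivation xi sending each arrow a to g_a; since m^r lies in the Jacobi
    ideal, the g_a have order at least 2, and xi raises the order.

    The exponential of xi therefore sends Phi to Phi + Theta up to terms of
    higher order. Finitely many (truncated) exponentials bring the difference
    into a power m^K with K > 2r. From there on the substitution a -> a + g_a
    that solves the problem exactly is a fixed point of a map
    g -> L(Theta - Q(g)), with L a bounded right inverse of
    g -> sum_a g_a D_a(Phi) and Q(g) the quadratic remainder of the substitution. The iteration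
    converges adically, and it stays in a small ball for the weighted norm
    sum_w |f_w| rho^|w|, so that its limit is analytic. Analyticity of the
    inverse of a substitution is obtained in the same way.

    If the Jacobi algebra is finite dimensional, then m^k is contained in
    m^(k+1) + J for some k, whence m^k is contained in J by Nakayama's lemma.

    All identities between series are proved by induction on the order, from
    the decomposition f = f_0 + sum_a a (der a f), where der a deletes the
    first arrow. *)
From HB Require Import structures.
Require Import Defs.
From mathcomp Require Import all_boot all_order all_algebra.
From mathcomp Require Import boolp classical_sets reals.
From mathcomp Require Import fsbigop complex ring lra zify.
Import Defs.

Set Implicit Arguments.
Unset Strict Implicit.
Unset Printing Implicit Defensive.

Import Order.TTheory GRing.Theory Num.Theory.
Import ComplexField.Normc.

Local Open Scope ring_scope.

(** * Left derivatives and orders of series *)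

(** Two stages are needed because each fails alone. Exponentials reach every finite order, but
    infinitely many of them need not share a radius of convergence. The fixed point needs a
    quadratic remainder that is small against Theta: inverting g -> sum_a g_a D_a(Phi) lowers the
    order by r and costs a factor rho^-r in norm. With Theta of order 2(r+2), g has order r+4; on
    the ball of radius eps = rho^(r+3) the remainder is at most a constant times (eps/rho)^2 =
    rho^(2r+4), so after division by rho^r one power of rho is left over to absorb all constants.

    The right inverse L is built from Jacobi expansions of the finitely many words of length r: a
    series of order r is cut into words of length r followed by tails, and modulo commutators these
    words are rotated behind the tails. This is why L has a uniform bound although the coefficients
    in the Jacobi ideal are bounded for each element separately.

    Norms are taken over words of bounded length, by recursion on [der]; convergence is a bound
    uniform in the length. *)

Lemma is_path_arrow (Q : quiver) (a : arrow Q) : is_path (src a) [:: a].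
Proof. by rewrite /= eqxx. Qed.

Definition arrow_path (Q : quiver) (a : arrow Q) : qpath Q :=
  @QPath Q (src a, [:: a]) (is_path_arrow a).

HB.lock Definition cst (R : realType) (Q : quiver) (f : series R Q) :
  series R Q := \sum_x coef f x [::] *: monomial R (trivial_path x).

Section Derivatives.
Variables (R : realType) (Q : quiver).
Notation S := (series R Q).
Implicit Types (f g h : S) (x y : vertex Q) (a b : arrow Q).
Implicit Types (w : seq (arrow Q)) (n k : nat).

Definition ev x : S := monomial R (trivial_path x).
Definition ar a : S := monomial R (arrow_path a).
Definition c0 f x : R[i] := coef f x [::].

Lemma cstE f : cst f = \sum_x c0 f x *: ev x. Proof. by rewrite cst.unlock. Qed.

Definition der a f : S := fun p =>
  if pstart p == tgt a then coef f (src a) (a :: parrows p) else 0.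

Lemma coef0 x w : coef (0 : S) x w = 0.
Proof. by rewrite /coef; case: insub. Qed.

Lemma coefZ (c : R[i]) f x w : coef (c *: f) x w = c * coef f x w.
Proof. by rewrite /coef; case: insub => //=; rewrite mulr0. Qed.

Lemma coefN f x w : coef (- f) x w = - coef f x w.
Proof. by rewrite /coef; case: insub => //=; rewrite oppr0. Qed.

Lemma coefB f g x w : coef (f - g) x w = coef f x w - coef g x w.
Proof. by rewrite coefD coefN. Qed.

Lemma coef_sum (I : Type) (r : seq I) (P : pred I) (F : I -> S) x w :
  coef (\sum_(i <- r | P i) F i) x w = \sum_(i <- r | P i) coef (F i) x w.
Proof.
exact: (big_morph (fun f => coef f x w) (fun f g => coefD f g x w) (coef0 x w)).
Qed.

Lemma coefM f g x w : coef (f * g) x w =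
  \sum_(i < (size w).+1)
     coef f x (take i w) * coef g (endpoint x (take i w)) (drop i w).
Proof. exact: coef_mul. Qed.

Lemma coef1 x w : coef (1 : S) x w = (w == [::])%:R.
Proof. exact: coef_one. Qed.

Lemma coef_monomial (q : qpath Q) x w :
  coef (monomial R q) x w = (val q == (x, w))%:R.
Proof.
case: (boolP (is_path x w)) => xw.
  by rewrite (coef_path _ xw) /monomial -(inj_eq val_inj) eq_sym.
rewrite coef_out //; case: eqP => // E; case/negP: xw.
by have := valP q; rewrite E.
Qed.

Lemma coef_ev x y w : coef (ev x) y w = ((y == x) && (w == [::]))%:R.
Proof. by rewrite coef_monomial /= xpair_eqE eq_sym [[::] == _]eq_sym. Qed.

Lemma coef_ar a y w : coef (ar a) y w = ((y == src a) && (w == [:: a]))%:R.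
Proof. by rewrite coef_monomial /= xpair_eqE eq_sym [_ == w]eq_sym. Qed.

Lemma coef_der a f x w :
  coef (der a f) x w = if x == tgt a then coef f (src a) (a :: w) else 0.
Proof.
case: (boolP (is_path x w)) => xw; first by rewrite (coef_path _ xw).
rewrite coef_out //; case: eqP => // xa.
by rewrite coef_out //= eqxx -xa.
Qed.

Lemma coef_evM x f y w : coef (ev x * f) y w = if y == x then coef f y w else 0.
Proof.
rewrite coefM big_ord_recl /= take0 drop0 coef_ev andbT big1 => [|i _].
  by rewrite addr0; case: (y == x); rewrite ?mul1r ?mul0r.
by rewrite coef_ev; case: w i => [[]//|b w i]; rewrite andbF mul0r.
Qed.

Lemma coef_Mev x f y w :
  coef (f * ev x) y w = if endpoint y w == x then coef f y w else 0.
Proof.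
rewrite coefM big_ord_recr /= take_size drop_size coef_ev andbT.
rewrite big1 => [|i _].
  by rewrite add0r; case: (_ == x); rewrite ?mulr1 ?mulr0.
by rewrite coef_ev -size_eq0 size_drop subn_eq0 leqNgt ltn_ord andbF mulr0.
Qed.

Lemma coef_arM0 a f y : coef (ar a * f) y [::] = 0.
Proof. by rewrite coefM big_ord_recl big_ord0 /= coef_ar andbF mul0r addr0. Qed.

Lemma coef_arM a f y b w : coef (ar a * f) y (b :: w) =
  if (y == src a) && (b == a) then coef f (tgt a) w else 0.
Proof.
rewrite coefM 2!big_ord_recl /= coef_ar andbF mul0r add0r big1 => [|i _].
  rewrite addr0 /= coef_ar take0 drop0 /endpoint /= eqseq_cons andbT.
  by case: eqP => //=; [case: eqP => [->|]|]; rewrite ?mul1r ?mul0r.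
by rewrite coef_ar; case: w i => [[]//|c w i] /=;
  rewrite !eqseq_cons !andbF mul0r.
Qed.

Lemma coef_Mar0 a f y : coef (f * ar a) y [::] = 0.
Proof. by rewrite coefM big_ord_recl big_ord0 /= coef_ar andbF mulr0 addr0. Qed.

Lemma coef_Mar a f y b w : coef (f * ar a) y (rcons w b) =
  if (endpoint y w == src a) && (b == a) then coef f y w else 0.
Proof.
rewrite coefM size_rcons 2!big_ord_recr /= [drop _.+1 _]drop_oversize
  ?size_rcons //.
rewrite [coef _ _ [::]]coef_ar andbF mulr0 addr0 -cats1 take_size_cat //.
rewrite drop_size_cat // coef_ar.
rewrite big1 => [|i _].
  rewrite add0r eqseq_cons andbT.
  by case: (_ && _); rewrite ?mulr1 ?mulr0.
rewrite coef_ar [_ == [:: a]](_ : _ = false) ?andbF ?mulr0 //.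
apply/eqP => /(congr1 size) /=; rewrite size_drop size_cat /=.
by move: (ltn_ord i) => /=; lia.
Qed.

Lemma scaleMl (c : R[i]) f g : (c *: f) * g = c *: (f * g).
Proof.
apply: series_ext => x w; rewrite coefZ !coefM mulr_sumr.
by apply: eq_bigr => i _; rewrite coefZ mulrA.
Qed.

Lemma scaleMr (c : R[i]) f g : f * (c *: g) = c *: (f * g).
Proof.
apply: series_ext => x w; rewrite coefZ !coefM mulr_sumr.
by apply: eq_bigr => i _; rewrite coefZ mulrCA.
Qed.

Lemma ev_ev x y : ev x * ev y = if x == y then ev x else 0.
Proof.
apply: series_ext => z w; rewrite coef_evM coef_ev.
case: (x =P y) => [<-|xy]; first by rewrite coef_ev; case: (z == x).
by rewrite coef0; case: (z =P x) => // ->; move/eqP: xy => /negPf ->.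
Qed.

Lemma ev_ar x a : ev x * ar a = if x == src a then ar a else 0.
Proof.
apply: series_ext => z w; rewrite coef_evM coef_ar.
case: (x =P src a) => [->|xa]; first by rewrite coef_ar; case: (z == src a).
by rewrite coef0; case: (z =P x) => // ->; move/eqP: xa => /negPf ->.
Qed.

Lemma ar_ev x a : ar a * ev x = if x == tgt a then ar a else 0.
Proof.
apply: series_ext => z w; rewrite coef_Mev coef_ar.
case: (w =P [:: a]) => [->|/eqP wa].
  by rewrite /endpoint /= eq_sym; case: ifP => _;
    rewrite ?coef0 // coef_ar eqxx.
by rewrite andbF if_same; case: ifP => _;
  rewrite ?coef0 // coef_ar (negPf wa) andbF.
Qed.

Lemma sum_ev : \sum_x ev x = 1.
Proof.
apply: series_ext => y w; rewrite coef_sum coef1 (bigD1 y) //= coef_ev eqxx /=.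
by rewrite big1 ?addr0 // => x xy; rewrite coef_ev eq_sym (negPf xy).
Qed.

Lemma c0D f g x : c0 (f + g) x = c0 f x + c0 g x. Proof. exact: coefD. Qed.
Lemma c0B f g x : c0 (f - g) x = c0 f x - c0 g x. Proof. exact: coefB. Qed.
Lemma c00 x : c0 0 x = 0. Proof. exact: coef0. Qed.
Lemma c0Z (c : R[i]) f x : c0 (c *: f) x = c * c0 f x. Proof. exact: coefZ. Qed.
Lemma c0M f g x : c0 (f * g) x = c0 f x * c0 g x.
Proof. by rewrite /c0 coefM big_ord_recl big_ord0 addr0. Qed.
Lemma c0_ev x y : c0 (ev x) y = (y == x)%:R.
Proof. by rewrite /c0 coef_ev andbT. Qed.
Lemma c0_ar a y : c0 (ar a) y = 0.
Proof. by rewrite /c0 coef_ar andbF. Qed.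
Lemma c0_sum (I : Type) (r : seq I) (P : pred I) (F : I -> S) x :
  c0 (\sum_(i <- r | P i) F i) x = \sum_(i <- r | P i) c0 (F i) x.
Proof. exact: coef_sum. Qed.

Lemma derD a f g : der a (f + g) = der a f + der a g.
Proof.
by apply: series_ext => x w; rewrite coefD !coef_der coefD; case: eqP;
  rewrite ?addr0.
Qed.

Lemma derB a f g : der a (f - g) = der a f - der a g.
Proof.
by apply: series_ext => x w; rewrite coefB !coef_der coefB; case: eqP;
  rewrite ?subr0.
Qed.

Lemma der0 a : der a 0 = 0.
Proof. by apply: series_ext => x w; rewrite coef_der !coef0 if_same. Qed.

Lemma derZ a (c : R[i]) f : der a (c *: f) = c *: der a f.
Proof.
by apply: series_ext => x w; rewrite coefZ !coef_der coefZ; case: eqP;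
  rewrite ?mulr0.
Qed.

Lemma der_sum (I : Type) (r : seq I) (P : pred I) (F : I -> S) a :
  der a (\sum_(i <- r | P i) F i) = \sum_(i <- r | P i) der a (F i).
Proof. exact: (big_morph (der a) (derD a) (der0 a)). Qed.

(** The second term comes from the factorizations whose left factor is a path of length 0. *)
Lemma derM a f g : der a (f * g) = der a f * g + c0 f (src a) *: der a g.
Proof.
apply: series_ext => x w; rewrite coefD coefZ !coef_der coefM.
case: (x =P tgt a) => [->|/eqP xa]; last first.
  rewrite coefM big1 ?add0r ?mulr0 // => i _.
  by rewrite coef_der (negPf xa) mul0r.
rewrite big_ord_recl /= addrC coefM; congr (_ + _).
by apply: eq_bigr => i _; rewrite coef_der eqxx /endpoint.
Qed.

Lemma der_ev a x : der a (ev x) = 0.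
Proof.
by apply: series_ext => y w; rewrite coef_der coef_ev andbF coef0 if_same.
Qed.

Lemma der_ar a b : der a (ar b) = if a == b then ev (tgt a) else 0.
Proof.
apply: series_ext => y w; rewrite coef_der coef_ar eqseq_cons.
case: (a =P b) => [->|]; last by rewrite andbF coef0 if_same.
by rewrite coef_ev eqxx; case: (y == tgt b).
Qed.

Lemma series_decomp f : f = cst f + \sum_a ar a * der a f.
Proof.
apply: series_ext => x w; rewrite cstE coefD !coef_sum.
have -> : \sum_y coef (c0 f y *: ev y) x w = if w is [::] then c0 f x else 0.
  rewrite (bigD1 x) //= big1 => [|y yx]; rewrite coefZ coef_ev.
    by rewrite eqxx addr0; case: w => [|b w]; rewrite ?mulr1 ?mulr0.
  by rewrite eq_sym (negPf yx) mulr0.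
case: w => [|b w]; first by rewrite big1 ?addr0 // => a _; rewrite coef_arM0.
rewrite add0r (bigD1 b) //= big1 => [|a ab]; rewrite coef_arM.
  rewrite eqxx andbT addr0 coef_der eqxx.
  by case: (x =P src b) => [->//|/eqP xb];
    rewrite coef_out //= eq_sym (negPf xb).
by rewrite [b == a]eq_sym (negPf ab) andbF.
Qed.

Lemma cstM_ev f x g : cst f * (ev x * g) = c0 f x *: (ev x * g).
Proof.
rewrite cstE mulr_suml (bigD1 x) //= big1 => [|y yx];
  rewrite scaleMl mulrA ev_ev.
  by rewrite eqxx addr0.
by rewrite (negPf yx) mul0r scaler0.
Qed.

Lemma cst_cst f g : cst f * cst g = cst (f * g).
Proof.
rewrite [cst g]cstE [in RHS]cstE mulr_sumr; apply: eq_bigr => x _.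
by rewrite scaleMr -[ev x]mulr1 cstM_ev mulr1 scalerA c0M mulrC.
Qed.

Lemma cstD f g : cst (f + g) = cst f + cst g.
Proof. by rewrite !cstE -big_split; apply: eq_bigr => x _;
  rewrite c0D scalerDl. Qed.

Lemma cstZ (c : R[i]) f : cst (c *: f) = c *: cst f.
Proof. by rewrite !cstE scaler_sumr; apply: eq_bigr => x _;
  rewrite c0Z scalerA. Qed.

Lemma cst_ev x : cst (ev x) = ev x.
Proof.
rewrite cstE (bigD1 x) //= big1 => [|y yx];
  rewrite c0_ev ?eqxx ?scale1r ?addr0 //.
by rewrite (negPf yx) scale0r.
Qed.

Lemma cst_ar a : cst (ar a) = 0.
Proof. by rewrite cstE big1 // => x _; rewrite c0_ar scale0r. Qed.

(* [order n f] says that f belongs to the n-th power of the arrow ideal. *)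
Definition order n f := forall x w, (size w < n)%N -> coef f x w = 0.

Lemma order0 f : order 0 f. Proof. by []. Qed.

Lemma order_zero n : order n 0. Proof. by move=> x w _; rewrite coef0. Qed.
Hint Resolve order0 order_zero : core.

Lemma orderW m n f : (n <= m)%N -> order m f -> order n f.
Proof. by move=> nm fm x w wn; apply: fm; apply: leq_trans wn nm. Qed.

Lemma order_eq0 f : (forall n, order n f) -> f = 0.
Proof.
by move=> f0; apply: series_ext => x w; rewrite coef0 (f0 (size w).+1).
Qed.

Lemma order_eq f g : (forall n, order n (f - g)) -> f = g.
Proof. by move=> fg; apply/eqP; rewrite -subr_eq0; apply/eqP/order_eq0. Qed.

Lemma orderD n f g : order n f -> order n g -> order n (f + g).
Proof. by move=> fn gn x w wn; rewrite coefD fn ?gn ?addr0. Qed.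

Lemma orderN n f : order n f -> order n (- f).
Proof. by move=> fn x w wn; rewrite coefN fn ?oppr0. Qed.

Lemma orderB n f g : order n f -> order n g -> order n (f - g).
Proof. by move=> fn gn; apply/orderD/orderN. Qed.

Lemma orderZ n (c : R[i]) f : order n f -> order n (c *: f).
Proof. by move=> fn x w wn; rewrite coefZ fn ?mulr0. Qed.

Lemma order_sum n (I : Type) (r : seq I) (P : pred I) (F : I -> S) :
  (forall i, P i -> order n (F i)) -> order n (\sum_(i <- r | P i) F i).
Proof.
by move=> Fn; elim/big_ind: _ => // f g; apply: orderD.
Qed.

Lemma orderM m n f g : order m f -> order n g -> order (m + n) (f * g).
Proof.
move=> fm gn x w wmn; rewrite coefM big1 // => -[i /= iw] _.
case: (ltnP i m) => im; first by rewrite fm ?mul0r // size_takel.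
by rewrite gn ?mulr0 // size_drop ltn_subLR // (leq_trans wmn) // leq_add2r.
Qed.

Lemma orderMl n f g : order n g -> order n (f * g).
Proof. exact: (@orderM 0). Qed.

Lemma orderMr n f g : order n f -> order n (f * g).
Proof. by move=> fn; rewrite -[n]addn0; apply: orderM. Qed.

Lemma order_trans n g f h : order n (f - g) -> order n (g - h) ->
  order n (f - h).
Proof. by move=> fg gh; rewrite -(subrK g f) -addrA; apply: orderD. Qed.

Lemma order_sym n f g : order n (f - g) -> order n (g - f).
Proof. by move/orderN; rewrite opprB. Qed.

Lemma order_ar a : order 1 (ar a).
Proof. by move=> x w; rewrite ltnS leqn0 size_eq0 coef_ar => /eqP ->;
  rewrite andbF. Qed.

Lemma order_c0 n f x : order n.+1 f -> c0 f x = 0.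
Proof. exact. Qed.

Lemma order1P f : (forall x, c0 f x = 0) -> order 1 f.
Proof. by move=> f0 x w; rewrite ltnS leqn0 size_eq0 => /eqP ->; apply: f0. Qed.

Lemma order_cst n f : order n.+1 f -> cst f = 0.
Proof. by move=> fn; rewrite cstE big1 // => x _;
  rewrite (order_c0 _ fn) scale0r. Qed.

Lemma order_der n a f : order n f -> order n.-1 (der a f).
Proof.
move=> fn x w wn; rewrite coef_der; case: eqP => // _; apply: fn => /=.
by case: n wn.
Qed.

Lemma order_rder n f : order n.+1 f -> f = \sum_a ar a * der a f.
Proof. by move=> fn; rewrite {1}[f]series_decomp (order_cst fn) add0r. Qed.

End Derivatives.

#[global] Hint Resolve order0 order_zero order_ar : core.

(** * Adic recursion and substitutions *)

(** If [u k.+1 - u k] has order k, the coefficients of length l are constant from index l+1 on, so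
    this diagonal is the adic limit. *)
HB.lock Definition alim (R : realType) (Q : quiver)
  (u : nat -> series R Q) : series R Q := fun p => u (plength p).+1 p.

Section AdicRecursion.
Variables (R : realType) (Q : quiver).
Notation S := (series R Q).
Implicit Types (f h : S) (x : vertex Q) (a b : arrow Q).
Implicit Types (w v : seq (arrow Q)) (n k : nat) (u : nat -> S).

Lemma coef_alim u x w : coef (alim u) x w = coef (u (size w).+1) x w.
Proof.
rewrite alim.unlock.
case: (boolP (is_path x w)) => xw; last by rewrite !coef_out.
by rewrite !(coef_path _ xw).
Qed.

Lemma alim_mod u n : (forall k, order k (u k.+1 - u k)) ->
  order n (alim u - u n).
Proof.
move=> uS x w wn; rewrite coefB coef_alim -(subnK wn).
elim: (n - _)%N => [|m IH]; first by rewrite subrr.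
have := uS (m + (size w).+1)%N x w; rewrite coefB ltn_addl // => /(_ isT).
by move/eqP; rewrite subr_eq0 => /eqP ->.
Qed.

Section Solution.
Variables (X : Type) (C : X -> S) (step : arrow Q -> X -> X) (y : arrow Q -> S).
Hypothesis y1 : forall a, order 1 (y a).

(** Unfolds [d s = C s + \sum_a y a * d (step a s)] n times. As every [y a] has order 1, the
    approximations agree up to order n. The state type is a parameter because it is a series for
    [subst] and a family of series for [bil]. *)
Fixpoint recn n (s : X) : S :=
  if n is n'.+1 then C s + \sum_a y a * recn n' (step a s) else 0.

Definition rec (s : X) : S := alim (recn^~ s).

Lemma recn_mod n s : order n (recn n.+1 s - recn n s).
Proof.
elim: n s => // n IH s; rewrite [recn n.+2 s]/= [recn n.+1 s in X in _ - X]/=.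
rewrite opprD addrACA subrr add0r -sumrB; apply: order_sum => a _.
by rewrite -mulrBr -add1n; apply: orderM => //; apply: IH.
Qed.

Lemma rec_mod n s : order n (rec s - recn n s).
Proof. by apply: alim_mod => k; apply: recn_mod. Qed.

Lemma recE s : rec s = C s + \sum_a y a * rec (step a s).
Proof.
apply: order_eq => n; apply: (@orderW _ _ n.+1) => //.
apply: order_trans; first exact: rec_mod.
rewrite /=.
rewrite opprD addrACA subrr add0r -sumrB; apply: order_sum => a _.
by rewrite -mulrBr -add1n; apply: orderM => //; apply/order_sym/rec_mod.
Qed.

End Solution.

(** Each unfolding multiplies the unknown d by another series of order 1, so in the end only the
    inhomogeneous term E limits the order of d. *)
Lemma rec_order (X : Type) (P : X -> Prop) (d E : X -> S)
    (step : arrow Q -> X -> X) (y : arrow Q -> S) k :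
  (forall a, order 1 (y a)) -> (forall s a, P s -> P (step a s)) ->
  (forall s, P s -> order k (E s)) ->
  (forall s, P s -> d s = E s + \sum_a y a * d (step a s)) ->
  forall s, P s -> order k (d s).
Proof.
move=> y1 PS Ek dE s Ps.
suff: forall j s, P s -> order (minn j k) (d s).
  by move/(_ k s Ps); rewrite minnn.
elim=> [|j IH] {Ps} {}s Ps; first by rewrite min0n.
rewrite dE //; apply: orderD.
  by apply: orderW (Ek s Ps); rewrite geq_minr.
apply: order_sum => a _; apply: (@orderW _ _ (1 + minn j k)); first lia.
by apply: orderM => //; apply/IH/PS.
Qed.

(** The tool for algebraic identities: both sides are shown to solve one recursion. *)
Lemma rec_unique (X : Type) (d e E : X -> S) (step : arrow Q -> X -> X)
    (y : arrow Q -> S) :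
  (forall a, order 1 (y a)) ->
  (forall s, d s = E s + \sum_a y a * d (step a s)) ->
  (forall s, e s = E s + \sum_a y a * e (step a s)) -> d =1 e.
Proof.
move=> y1 dE eE s; apply: order_eq => n.
apply: (@rec_order X (fun=> True) (fun s => d s - e s) (fun=> 0) step y) => //.
move=> {}s _; rewrite add0r dE eE opprD addrACA subrr add0r -sumrB.
by apply: eq_bigr => a _; rewrite mulrBr.
Qed.

(** The estimate for maps that trade one arrow of each word for a series of order s. The induction
    closes because [der a] costs one order and [y a] gives it back. *)
Lemma rec_order_shift (d E : S -> S) (y : arrow Q -> S) s :
  (forall a, order 1 (y a)) ->
  (forall f, d f = E f + \sum_a y a * d (der a f)) ->
  (forall n f, order n f -> order (n.-1 + s) (E f)) ->
  forall n f, order n f -> order (n.-1 + s) (d f).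
Proof.
move=> y1 dE Es; elim=> [|n IH] f fn.
  by apply: (rec_order (P := fun=> True) y1 _ _ (fun f _ => dE f)) => // h _;
    apply: (Es 0).
rewrite dE; apply: orderD; first exact: Es.
apply: order_sum => a _; apply: (@orderW _ _ (1 + (n.-1 + s))); first lia.
by apply: orderM => //; apply: IH; exact: order_der fn.
Qed.

Section Substitution.
Variable g : arrow Q -> S.

(** The factor in front enforces the starting vertex; in [subst] the tail [subst (der a f)] starts
    at [tgt a] and enforces the other end. *)
Definition image a : S := ev R (src a) * (ar R a + g a).

(* The continuous algebra endomorphism sending each arrow a to [image a],
   up to multiplication by the end vertex of a. *)
Definition subst : S -> S := rec (@cst R Q) (@der R Q) image.

Lemma imageE a : image a = ar R a + ev R (src a) * g a.
Proof. by rewrite /image mulrDr ev_ar eqxx. Qed.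

Lemma ev_image x a : ev R x * image a = if x == src a then image a else 0.
Proof. by rewrite mulrA ev_ev; case: eqP => [->|]; rewrite ?mul0r. Qed.

Hypothesis g1 : forall a, order 1 (g a).

Lemma order_image a : order 1 (image a).
Proof. by apply/orderMl/orderD. Qed.
Hint Resolve order_image : core.

Lemma substE f : subst f = cst f + \sum_a image a * subst (der a f).
Proof. exact: recE. Qed.

Lemma substD f h : subst (f + h) = subst f + subst h.
Proof.
apply: (rec_unique (step := fun a s => (der a s.1, der a s.2)) (y := image)
  (d := fun s => subst (s.1 + s.2)) (e := fun s => subst s.1 + subst s.2)
  (E := fun s => cst (s.1 + s.2)) _ _ _ (f, h)) => // {f h} -[f h] /=.
  by rewrite substE; congr (_ + _); apply: eq_bigr => a _; rewrite derD.
rewrite (substE f) (substE h) addrACA -cstD -big_split /=.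
by congr (_ + _); apply: eq_bigr => a _; rewrite mulrDr.
Qed.

Lemma substZ (c : R[i]) f : subst (c *: f) = c *: subst f.
Proof.
apply: (rec_unique (step := @der R Q) (y := image)
  (d := fun s => subst (c *: s)) (e := fun s => c *: subst s)
  (E := fun s => cst (c *: s))) => // {}f.
  by rewrite substE; congr (_ + _); apply: eq_bigr => a _; rewrite derZ.
rewrite (substE f) scalerDr cstZ [X in _ + X]scaler_sumr; congr (_ + _).
by apply: eq_bigr => a _; rewrite scaleMr.
Qed.

Lemma subst0 : subst 0 = 0.
Proof. by have := substZ 0 0; rewrite !scale0r. Qed.

Lemma subst_ev x : subst (ev R x) = ev R x.
Proof.
rewrite substE cst_ev big1 ?addr0 // => a _.
by rewrite der_ev subst0 mulr0.
Qed.

Lemma substM f h : subst (f * h) = subst f * subst h.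
Proof.
(* The recursion runs on the left factor with h fixed; words whose first arrow already lies in h
   form the inhomogeneous term. *)
apply: (rec_unique (step := @der R Q) (y := image)
  (d := fun s => subst (s * h)) (e := fun s => subst s * subst h)
  (E := fun s => cst (s * h) +
     \sum_a c0 s (src a) *: (image a * subst (der a h)))) => // {}f.
  rewrite substE -addrA -big_split /=; congr (_ + _).
  apply: eq_bigr => a _; rewrite derM substD substZ mulrDr scaleMr.
  by rewrite addrC.
rewrite [in LHS](substE f) mulrDl mulr_suml; congr (_ + _); last first.
  by apply: eq_bigr => a _; rewrite mulrA.
rewrite (substE h) mulrDr cst_cst mulr_sumr; congr (_ + _).
apply: eq_bigr => a _.
have <- : ev R (src a) * image a = image a by rewrite ev_image eqxx.
by rewrite -!mulrA cstM_ev.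
Qed.

Lemma subst_ar a : subst (ar R a) = image a * ev R (tgt a).
Proof.
rewrite substE cst_ar add0r (bigD1 a) //= big1 => [|b ba]; rewrite der_ar.
  by rewrite eqxx subst_ev addr0.
by rewrite (negPf ba) subst0 mulr0.
Qed.

Lemma subst_order n f : order n f -> order n (subst f).
Proof.
elim: n f => // n IH f fn; rewrite substE (order_cst fn) add0r.
apply: order_sum => a _; rewrite -add1n; apply: orderM => //.
by apply: IH; exact: order_der fn.
Qed.

End Substitution.

(** * Sums over all paths and their coefficients *)

Section Bilinear.
Implicit Types A : vertex Q -> seq (arrow Q) -> S.

Definition shift A b : vertex Q -> seq (arrow Q) -> S :=
  fun _ v => A (src b) (b :: v).

(* The sum of [v * h * A y v] over the paths v starting at y. *)
Definition bil_head h A : S := \sum_x ev R x * h * A x [::].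
Definition bil A h : S := rec (bil_head h) (fun b A => shift A b) (@ar R Q) A.

(* The sum of [A y v * X * v] over the paths v of length < n starting at y. *)
Fixpoint jsum n A (X : S) : S :=
  if n is n'.+1 then
    \sum_x A x [::] * X * ev R x + \sum_b jsum n' (shift A b) (X * ar R b)
  else 0.

Lemma bilE A h : bil A h = bil_head h A + \sum_b ar R b * bil (shift A b) h.
Proof. exact: recE. Qed.

Lemma bilD A h1 h2 : bil A (h1 + h2) = bil A h1 + bil A h2.
Proof.
apply: (rec_unique (step := fun b A => shift A b) (y := @ar R Q)
  (d := fun A => bil A (h1 + h2)) (e := fun A => bil A h1 + bil A h2)
  (E := bil_head (h1 + h2))) => // {}A; first exact: bilE.
rewrite (bilE A h1) (bilE A h2) addrACA -!big_split /=; congr (_ + _).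
  by apply: eq_bigr => x _; rewrite mulrDr mulrDl.
by apply: eq_bigr => b _; rewrite mulrDr.
Qed.

Lemma bilZ A (c : R[i]) h : bil A (c *: h) = c *: bil A h.
Proof.
apply: (rec_unique (step := fun b A => shift A b) (y := @ar R Q)
  (d := fun A => bil A (c *: h)) (e := fun A => c *: bil A h)
  (E := bil_head (c *: h))) => // {}A; first exact: bilE.
rewrite (bilE A h) scalerDr !scaler_sumr; congr (_ + _).
  by apply: eq_bigr => x _; rewrite scaleMr scaleMl.
by apply: eq_bigr => b _; rewrite scaleMr.
Qed.

Lemma bilB A h1 h2 : bil A (h1 - h2) = bil A h1 - bil A h2.
Proof. by rewrite bilD -scaleN1r bilZ scaleN1r. Qed.

Lemma bil_order n A h : order n h -> order n (bil A h).
Proof.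
move=> hn; apply: (rec_order (P := fun=> True) (E := bil_head h)
  (step := fun b A => shift A b) (y := @ar R Q) (d := bil^~ h)) => // {}A _.
  by apply: order_sum => x _; apply/orderMr/orderMl.
exact: bilE.
Qed.

Lemma jsumMl n A X h : h * jsum n A X = jsum n (fun x v => h * A x v) X.
Proof.
elim: n A X => [|n IH] A X /=; first by rewrite mulr0.
rewrite mulrDr !mulr_sumr; congr (_ + _); first by apply: eq_bigr => x _;
  rewrite !mulrA.
by apply: eq_bigr => b _; rewrite IH.
Qed.

Lemma jsumD n A A' X :
  jsum n (fun x v => A x v + A' x v) X = jsum n A X + jsum n A' X.
Proof.
elim: n A A' X => [|n IH] A A' X /=; first by rewrite addr0.
rewrite addrACA -!big_split; congr (_ + _).
  by apply: eq_bigr => x _; rewrite !mulrDl.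
by apply: eq_bigr => b _; apply: (IH (shift A b) (shift A' b)).
Qed.

(** k is the length of v, read as a suffix of w; a path has one suffix of each length, which leaves
    a single sum. *)
Lemma coef_jsum n A X x w : is_path x w -> coef (jsum n A X) x w =
  \sum_(0 <= k < n) if (k <= size w)%N then
    coef (A (endpoint x (take (size w - k) w)) (drop (size w - k) w) * X)
         x (take (size w - k) w) else 0.
Proof.
move=> xw; elim: n A X => [|n IH] A X; first by rewrite big_nil coef0.
rewrite big_nat_recl // coefD !coef_sum subn0 take_size drop_size /=.
congr (_ + _).
  rewrite (bigD1 (endpoint x w)) //= coef_Mev eqxx big1 ?addr0 // => y yx.
  by rewrite coef_Mev eq_sym (negPf yx).
under eq_bigr do rewrite IH; rewrite exchange_big /=.
apply: eq_big_nat => k _; case: (leqP k (size w)) => kw; last first.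
  by rewrite big1 // ifF //; apply/negbTE; rewrite -ltnNge ltnW.
case: ltnP => kw'; last first.
  have -> : (size w - k = 0)%N by apply/eqP; rewrite subn_eq0.
  by rewrite take0 big1 // => b _; rewrite mulrA coef_Mar0.
have -> : (size w - k = (size w - k.+1).+1)%N by lia.
have : (size w - k.+1 < size w)%N by lia.
move: (size w - k.+1)%N => i iw {IH kw kw'}.
have [b wi] : exists b, drop i w = b :: drop i.+1 w.
  by case: w iw {xw} => // b0 w iw; exists (nth b0 (b0 :: w) i);
    rewrite -drop_nth.
have wi' : take i.+1 w = rcons (take i w) b.
  by rewrite -addn1 takeD wi /= take0 cats1.
have sb : src b = endpoint x (take i w).
  move: xw; rewrite -{1}(cat_take_drop i w) wi is_path_cat => /andP[_ /=].
  by case/andP => /eqP.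
rewrite (bigD1 b) //= big1 => [|c cb].
  rewrite wi' mulrA coef_Mar -sb !eqxx /= addr0 /shift.
  by rewrite -wi sb.
by rewrite wi' mulrA coef_Mar [b == c]eq_sym (negPf cb) andbF.
Qed.

End Bilinear.

End AdicRecursion.

(** * Commutators and derivations *)

Section Commutators.
Variables (R : realType) (Q : quiver).
Notation S := (series R Q).
Implicit Types (f h X : S) (x : vertex Q) (a b : arrow Q).
Implicit Types (w v : seq (arrow Q)) (n k : nat) (g : arrow Q -> S).

(** The commutators may depend on n; the property for all n is membership in the adic closure, that
    is, vanishing as a potential. *)
Definition comm n f := exists2 c, @commutators S c & order n (f - c).

Lemma comm_order n f : order n f -> comm n f.
Proof. by move=> fn; exists 0; [exact: commutators0|rewrite subr0]. Qed.

Lemma commB n f h : comm n f -> comm n h -> comm n (f - h).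
Proof.
move=> [c cc fc] [d dc hd]; exists (c - d); first exact: commutatorsB.
by rewrite opprD addrACA -opprD; apply: orderB.
Qed.

Lemma commN n f : comm n f -> comm n (- f).
Proof. by rewrite -sub0r => fn; apply: commB => //; apply: comm_order. Qed.

Lemma commD n f h : comm n f -> comm n h -> comm n (f + h).
Proof. by move=> fn /commN hn; rewrite -[h]opprK; apply: commB. Qed.

Lemma comm_sum n (I : Type) (r : seq I) (P : pred I) (F : I -> S) :
  (forall i, P i -> comm n (F i)) -> comm n (\sum_(i <- r | P i) F i).
Proof.
move=> Fn; elim/big_ind: _ => //; first exact: comm_order.
by move=> f h; apply: commD.
Qed.

Lemma comm_bracket n f h : comm n (f * h - h * f).
Proof.
by exists (f * h - h * f); rewrite ?subrr //; exists [:: (f, h)];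
  rewrite big_seq1.
Qed.

Lemma comm_trans n f h X : comm n (f - h) -> comm n (h - X) -> comm n (f - X).
Proof. by move=> fh hX; rewrite -(subrK h f) -addrA; apply: commD. Qed.

Lemma comm_sym n f h : comm n (f - h) -> comm n (h - f).
Proof. by move/commN; rewrite opprB. Qed.

Lemma comm_map n (chi : S -> S) f :
  (forall f h, chi (f - h) = chi f - chi h) ->
  (forall f h, @commutators S (chi (f * h - h * f))) ->
  (forall f, order n f -> order n (chi f)) ->
  comm n f -> comm n (chi f).
Proof.
move=> chiB chiC chin [_ [s ->] fc].
set c := \sum_(gh <- s) _ in fc *; exists (chi c); last first.
  by rewrite -chiB; apply: chin.
have chi0 : chi 0 = 0 by have := chiB 0 0; rewrite !subrr.
rewrite /c {c fc}; elim: s => [|gh s IH].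
  by rewrite big_nil chi0; apply: commutators0.
rewrite big_cons -[X in _ + X]opprK chiB -[- \sum_(_ <- _) _]sub0r [chi (0 -
  _)]chiB chi0.
apply: commutatorsB => //; apply: commutatorsB => //.
exact: commutators0.
Qed.

Lemma comm_commutators n f : @commutators S f -> comm n f.
Proof. by move=> fc; exists f; rewrite ?subrr. Qed.

Lemma commZ n c f : comm n f -> comm n (c *: f).
Proof.
apply: (comm_map (chi := fun f => c *: f)) => [{}f h|{}f h|{}f];
  last exact: orderZ.
  exact: scalerBr.
exists [:: (c *: f, h)]; rewrite big_seq1 /= scaleMl scaleMr.
exact: scalerBr.
Qed.

(** Cyclicity: each term [v * h * A y v * X] is rotated to [h * A y v * X * v], one arrow at a time.
    What remains after n rotations carries n further arrows behind X, hence order k + n. *)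
Lemma bil_jsum k n A h X : order k X ->
  comm (k + n) (bil A h * X - h * jsum n A X).
Proof.
elim: n k A X => [|n IH] k A X Xk.
  by apply: comm_order; rewrite /= mulr0 subr0 addn0; apply: orderMl.
rewrite bilE mulrDl /= mulrDr opprD addrACA !mulr_suml !mulr_sumr -!sumrB.
apply: commD; [apply: comm_sum => x _|apply: comm_sum => b _].
  by have := @comm_bracket (k + n.+1) (ev R x) (h * A x [::] * X);
    rewrite !mulrA.
rewrite -mulrA; apply: (@comm_trans _ _ (bil (shift A b) h * X * ar R b)).
  exact: comm_bracket.
rewrite -mulrA addnS -addSn; apply: IH; rewrite -addn1.
exact: orderM.
Qed.

Lemma coef_jsum_full n A X x w : is_path x w -> (size w < n)%N ->
  coef (jsum n A X) x w = \sum_(i < (size w).+1)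
    coef (A (endpoint x (take i w)) (drop i w) * X) x (take i w).
Proof.
move=> xw wn; rewrite coef_jsum // (big_cat_nat (n := (size w).+1)) //=.
rewrite [X in _ + X]big_nat_cond [X in _ + X]big1 ?addr0; last first.
  by move=> i /andP[/andP[wi _] _]; rewrite leqNgt wi.
rewrite -(big_mkord xpredT (fun i =>
  coef (A (endpoint x (take i w)) (drop i w) * X) x (take i w))) big_nat_rev /=.
apply: eq_big_nat => i /andP[_ iw]; rewrite add0n subSS.
by rewrite leq_subr subKn.
Qed.

(** The part of f behind the prefix v a. Multiplying it by v on the right turns the word v a u of f
    into u v, its contribution to the cyclic derivative. *)
Definition lfam a f : vertex Q -> seq (arrow Q) -> S :=
  fun _ v => der a (foldl (fun f b => der b f) f v).

Lemma coef_foldl_der f y v w : is_path y v ->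
  coef (foldl (fun f b => der b f) f v) (endpoint y v) w = coef f y (v ++ w).
Proof.
elim: v f y => //= b v IH f y /andP[/eqP <- bv].
by rewrite [endpoint _ _](_ : _ = endpoint (tgt b) v) // IH // coef_der eqxx.
Qed.

Lemma jsum_cyclic_derivative n a f :
  order n (jsum n (lfam a f) 1 * ev R (src a) - cyclic_derivative a f).
Proof.
move=> x w wn; case: (boolP (is_path x w)) => xw; last by rewrite coef_out.
rewrite coefB coef_Mev (coef_path (cyclic_derivative a f) xw).
rewrite /cyclic_derivative /pstart /pend /plength /parrows /=.
case: (endpoint x w =P src a) => [xwa|]; last by rewrite andbF subrr.
rewrite andbT coef_jsum_full //; case: (x =P tgt a) => [xa|/eqP xa]; last first.
  by rewrite subr0 big1 // => i _; rewrite mulr1 coef_der (negPf xa).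
apply/eqP; rewrite subr_eq0; apply/eqP/eq_bigr => i _.
rewrite mulr1 coef_der xa eqxx -xa.
have -> : src a = endpoint (endpoint x (take i w)) (drop i w).
  by rewrite -endpoint_cat cat_take_drop.
rewrite coef_foldl_der //.
by move: xw; rewrite -{1}(cat_take_drop i w) is_path_cat => /andP[].
Qed.

(* The continuous derivation sending each arrow a to [ev (src a) * g a]. *)
Definition xi g f : S := \sum_a bil (lfam a f) (ev R (src a) * g a).

(** Replacing a by g_a in v a u gives v g_a u, which rotates to g_a u v; collecting the u v yields
    the cyclic derivative. *)
Lemma xi_cyclic_derivative g f n :
  comm n (xi g f - \sum_a g a * cyclic_derivative a f).
Proof.
rewrite -sumrB; apply: comm_sum => a _.
apply: (@comm_trans _ _ (ev R (src a) * g a * jsum n (lfam a f) 1)).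
  by rewrite -[X in X - _]mulr1; apply: (@bil_jsum 0).
rewrite -mulrA; apply: comm_trans; first exact: comm_bracket.
rewrite -mulrA -mulrBr; apply/comm_order/orderMl.
exact: jsum_cyclic_derivative.
Qed.

Section Derivation.
Variable g : arrow Q -> S.

Lemma xiE f : xi g f = \sum_a ev R (src a) * g a * der a f +
  \sum_b ar R b * xi g (der b f).
Proof.
rewrite /xi; under [X in _ = _ + X]eq_bigr do rewrite mulr_sumr.
rewrite exchange_big /= -big_split; apply: eq_bigr => a _; rewrite bilE /=.
congr (_ + _); rewrite /bil_head /lfam /=.
by rewrite -[in LHS]mulr_suml -mulr_suml sum_ev mul1r.
Qed.

Lemma xiD f h : xi g (f + h) = xi g f + xi g h.
Proof.
apply: (rec_unique (step := fun a s => (der a s.1, der a s.2)) (y := @ar R Q)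
  (d := fun s => xi g (s.1 + s.2)) (e := fun s => xi g s.1 + xi g s.2)
  (E := fun s => \sum_a ev R (src a) * g a * der a (s.1 + s.2)) _ _ _ (f, h))
  => // {f h} -[f h] /=.
  by rewrite xiE; congr (_ + _); apply: eq_bigr => a _; rewrite derD.
rewrite (xiE f) (xiE h) addrACA -2!big_split; congr (_ + _);
  apply: eq_bigr => a _ /=.
  by rewrite derD mulrDr.
by rewrite mulrDr.
Qed.

Lemma xiZ (c : R[i]) f : xi g (c *: f) = c *: xi g f.
Proof.
apply: (rec_unique (step := @der R Q) (y := @ar R Q)
  (d := fun s => xi g (c *: s)) (e := fun s => c *: xi g s)
  (E := fun s => \sum_a ev R (src a) * g a * der a (c *: s))) => // {}f.
  by rewrite xiE; congr (_ + _); apply: eq_bigr => a _; rewrite derZ.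
rewrite (xiE f) scalerDr !scaler_sumr; congr (_ + _); apply: eq_bigr => a _ /=.
  by rewrite derZ scaleMr.
by rewrite scaleMr.
Qed.

Lemma xi0 : xi g 0 = 0. Proof. by have := xiZ 0 0; rewrite !scale0r. Qed.

Lemma xiB f h : xi g (f - h) = xi g f - xi g h.
Proof. by rewrite xiD -scaleN1r xiZ scaleN1r. Qed.

Lemma xi_ev x : xi g (ev R x) = 0.
Proof.
rewrite xiE big1 => [|a _]; last by rewrite der_ev mulr0.
by rewrite big1 ?addr0 // => a _; rewrite der_ev xi0 mulr0.
Qed.

Lemma xiM f h : xi g (f * h) = xi g f * h + f * xi g h.
Proof.
apply: (rec_unique (step := @der R Q) (y := @ar R Q)
  (d := fun s => xi g (s * h)) (e := fun s => xi g s * h + s * xi g h)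
  (E := fun s => \sum_a ev R (src a) * g a * der a (s * h) +
    \sum_a c0 s (src a) *: (ar R a * xi g (der a h)))) => // {}f.
  rewrite xiE -addrA; congr (_ + _); rewrite -big_split /=.
  apply: eq_bigr => a _; rewrite derM xiD xiZ mulrDr scaleMr.
  by rewrite addrC.
have fE : f * xi g h = \sum_a c0 f (src a) *: (ev R (src a) * g a * der a h) +
    (\sum_a c0 f (src a) *: (ar R a * xi g (der a h)) +
     \sum_a ar R a * (der a f * xi g h)).
  rewrite {1}[f]series_decomp mulrDl addrA; congr (_ + _); last first.
    by rewrite mulr_suml; apply: eq_bigr => a _; rewrite mulrA.
  rewrite {1}(xiE h) mulrDr !mulr_sumr; congr (_ + _); apply: eq_bigr => a _.
    by rewrite -mulrA cstM_ev.
  have <- : ev R (src a) * ar R a = ar R a by rewrite ev_ar eqxx.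
  by rewrite -mulrA cstM_ev.
have gE : \sum_a ev R (src a) * g a * der a (f * h) =
    \sum_a ev R (src a) * g a * der a f * h +
    \sum_a c0 f (src a) *: (ev R (src a) * g a * der a h).
  rewrite -big_split; apply: eq_bigr => a _ /=.
  by rewrite derM mulrDr mulrA scaleMr.
have aE : \sum_a ar R a * (xi g (der a f) * h + der a f * xi g h) =
    \sum_a ar R a * xi g (der a f) * h + \sum_a ar R a * (der a f * xi g h).
  by rewrite -big_split; apply: eq_bigr => a _ /=; rewrite mulrDr mulrA.
rewrite gE aE fE (xiE f) mulrDl !mulr_suml -!addrA; congr (_ + _).
by rewrite [LHS]addrCA [X in _ + X = _]addrCA.
Qed.

Lemma xi_order s n f : (forall a, order s.+1 (g a)) -> order n f ->
  order (n + s) (xi g f).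
Proof.
move=> gs fn; apply: (@orderW _ _ (n.-1 + s.+1)); first lia.
apply: (rec_order_shift (@order_ar R Q) xiE) fn => {}n {}f fn.
apply: order_sum => a _; rewrite addnC; apply: orderM; first exact: orderMl.
exact: order_der fn.
Qed.

Lemma xi_comm n f : (forall a, order 1 (g a)) -> comm n f -> comm n (xi g f).
Proof.
move=> g1; apply: comm_map => [||h hn]; first exact: xiB.
  move=> {}f h; exists [:: (xi g f, h); (f, xi g h)].
  rewrite big_cons big_seq1 /= xiB !xiM opprD.
  by rewrite [- (xi g h * f) - _]addrC addrACA.
by rewrite -[n]addn0; apply: xi_order.
Qed.

End Derivation.
End Commutators.

(** * Taylor remainder, adic fixed points and endomorphisms *)

Section AdicSubstitution.
Variables (R : realType) (Q : quiver).
Notation S := (series R Q).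
Implicit Types (f h X : S) (x : vertex Q) (a b : arrow Q).
Implicit Types (w v : seq (arrow Q)) (n k s d : nat) (g : arrow Q -> S).

Lemma subst_subE g f : (forall a, order 1 (g a)) ->
  subst g f - f = \sum_a ev R (src a) * g a * subst g (der a f) +
    \sum_a ar R a * (subst g (der a f) - der a f).
Proof.
move=> g1; rewrite substE // [X in _ - X]series_decomp opprD addrACA subrr
  add0r.
rewrite -sumrB -big_split; apply: eq_bigr => a _ /=.
by rewrite imageE mulrDl mulrBr addrAC addrC.
Qed.

Lemma subst_sub_order g s n f : (0 < s)%N -> (forall a, order s (g a)) ->
  order n f -> order (n.-1 + s) (subst g f - f).
Proof.
move=> s0 gs; have g1 a : order 1 (g a) by apply: orderW (gs a).
apply: (rec_order_shift (@order_ar R Q) (fun f => subst_subE f g1)) => {}n {}f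
  fn.
apply: order_sum => a _; rewrite addnC; apply: orderM; first exact: orderMl.
by apply: subst_order => //; exact: order_der fn.
Qed.

(** The Taylor remainder: the terms of the substitution in which at least two arrows are
    replaced. *)
Definition remainder g f : S := subst g f - f - xi g f.

Lemma remainderE g f : (forall a, order 1 (g a)) ->
  remainder g f = \sum_a ev R (src a) * g a * (subst g (der a f) - der a f) +
    \sum_a ar R a * remainder g (der a f).
Proof.
move=> g1; rewrite /remainder subst_subE // xiE opprD addrACA -!sumrB.
by congr (_ + _); apply: eq_bigr => a _; rewrite -mulrBr.
Qed.

Lemma remainder_order g s f : (0 < s)%N -> (forall a, order s (g a)) ->
  order (s + s) (remainder g f).
Proof.
move=> s0 gs; have g1 a : order 1 (g a) by apply: orderW (gs a).
apply: (rec_order (P := fun=> True) (@order_ar R Q) _ _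
  (fun f _ => remainderE f g1)) => // {}f _.
apply: order_sum => a _; apply: orderM; first exact: orderMl.
exact: (@subst_sub_order _ s 0).
Qed.

Section Contraction.
Variables (g g' : arrow Q -> S) (s d : nat).
Hypotheses (s0 : (0 < s)%N) (gs : forall a, order s (g a)).
Hypotheses (gs' : forall a, order s (g' a)).
Hypothesis gg' : forall a, order d (g a - g' a).

Let g1 a : order 1 (g a). Proof. exact: orderW (gs a). Qed.
Let g1' a : order 1 (g' a). Proof. exact: orderW (gs' a). Qed.

Lemma subst_contract n f : order n f ->
  order (n.-1 + d) (subst g f - subst g' f).
Proof.
(* Telescoping along each word: one arrow contributes [g a - g' a], those before it are mapped by g'
   and those after it by g. *)
apply: (rec_order_shift (y := image g') (d := fun f => subst g f - subst g' f)
    (E := fun f => \sum_a ev R (src a) * (g a - g' a) * subst g (der a f)))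
  => [a|{n}f|{}n {}f fn]; first exact: order_image.
  rewrite (substE g1 f) (substE g1' f) opprD addrACA subrr add0r -sumrB.
  rewrite -big_split; apply: eq_bigr => a _ /=.
  have -> : ev R (src a) * (g a - g' a) = image g a - image g' a.
    by rewrite !imageE opprD addrACA subrr add0r mulrBr.
  by rewrite mulrBl mulrBr addrA subrK.
apply: order_sum => a _; rewrite addnC; apply: orderM; first exact: orderMl.
by apply: subst_order => //; exact: order_der fn.
Qed.

Lemma remainder_contract f : order (d + s) (remainder g f - remainder g' f).
Proof.
(* The difference of two products is split in the usual way, so that each summand pairs a factor of
   order d with one of order s. *)
apply: (rec_order (P := fun=> True) (step := @der R Q) (y := @ar R Q)
    (d := fun f => remainder g f - remainder g' f)
    (E := fun f => \sum_a (ev R (src a) * (g a - g' a) * (subst g (der a f) -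
      der a f) +
      ev R (src a) * g' a * (subst g (der a f) - subst g' (der a f))))) => //
        {}f _.
  apply: order_sum => a _; apply: orderD.
    apply: orderM; first exact: orderMl.
    exact: (@subst_sub_order _ s 0).
  rewrite addnC; apply: orderM; first exact: orderMl.
  exact: (@subst_contract 0).
rewrite (remainderE f g1) (remainderE f g1') opprD addrACA -!sumrB.
congr (_ + _); apply: eq_bigr => a _; last by rewrite -mulrBr.
have -> : subst g (der a f) - subst g' (der a f) =
    (subst g (der a f) - der a f) - (subst g' (der a f) - der a f).
  by rewrite opprB addrA subrK.
move: (subst g _ - _) (subst g' _ - _) => A B.
by rewrite [_ * (g a - _)]mulrBr mulrBl [_ * (A - B)]mulrBr addrA subrK.
Qed.

End Contraction.

(** Contraction principle for the adic topology. The conclusion keeps the iterates, because norm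
    bounds are proved for them and pass to the limit by [wbounded_limit]. *)
Lemma adic_fixpoint (T : (arrow Q -> S) -> arrow Q -> S) s :
  (forall g, (forall a, order s (g a)) -> forall a, order s (T g a)) ->
  (forall g g' d, (forall a, order s (g a)) -> (forall a, order s (g' a)) ->
     (forall a, order d (g a - g' a)) ->
       forall a, order d.+1 (T g a - T g' a)) ->
  exists g, [/\ forall a, order s (g a), forall a, g a = T g a &
    forall k a, order k (g a - iter k T (fun=> 0) a)].
Proof.
move=> Ts Tc; pose u k := iter k T (fun=> 0).
have us k a : order s (u k a) by elim: k a => [|k IH] a;
  [exact: order_zero|exact: Ts IH a].
have uS k a : order k (u k.+1 a - u k a).
  by elim: k a => [|k IH] a; [exact: order0|exact: Tc (us k.+1) (us k) IH a].
pose g a := alim (u^~ a); have gu k a : order k (g a - u k a).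
  by apply: (alim_mod (u := u^~ a)) => j; apply: uS.
have gs a : order s (g a).
  by rewrite -(subrK (u s a) (g a)); apply: orderD.
exists g; split=> // a; apply: order_eq => n.
apply: (@order_trans _ _ _ (u n.+1 a)); first exact: orderW (gu n.+1 a).
apply: (@orderW _ _ n.+1) => //; apply: Tc => // b; exact: order_sym.
Qed.

(** Fixing the vertices expresses l-linearity; preserving orders lets chi carry congruences modulo
    [comm n]. *)
Definition endo (chi : S -> S) := [/\
  forall (c : R[i]) f h, chi (c *: f + h) = c *: chi f + chi h,
  forall f h, chi (f * h) = chi f * chi h,
  forall x, chi (ev R x) = ev R x &
  forall n f, order n f -> order n (chi f)].

Lemma endoD chi f h : endo chi -> chi (f + h) = chi f + chi h.
Proof. by case=> L _ _ _; have := L 1 f h; rewrite !scale1r. Qed.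

Lemma endoB chi f h : endo chi -> chi (f - h) = chi f - chi h.
Proof.
by case=> L _ _ _; have := L (-1) h f; rewrite !scaleN1r ![- _ + _]addrC.
Qed.

Lemma endo0 chi : endo chi -> chi 0 = 0.
Proof. by move=> e; have := endoB 0 0 e; rewrite !subrr. Qed.

Lemma endoZ chi c f : endo chi -> chi (c *: f) = c *: chi f.
Proof.
by move=> e; case: (e) => L _ _ _; rewrite -[c *: f]addr0 L (endo0 e) addr0.
Qed.

Lemma endo_sum chi (I : Type) (r : seq I) (P : pred I) (F : I ->
  S) : endo chi ->
  chi (\sum_(i <- r | P i) F i) = \sum_(i <- r | P i) chi (F i).
Proof.
move=> e; exact: (big_morph chi (fun f h => endoD f h e) (endo0 e)).
Qed.

Lemma endo1 chi : endo chi -> chi 1 = 1.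
Proof.
move=> e; rewrite -(sum_ev R Q) (endo_sum _ _ _ e).
by apply: eq_bigr => x _; case: e.
Qed.

Lemma endo_cst chi f : endo chi -> chi (cst f) = cst f.
Proof.
move=> e; rewrite cstE (endo_sum _ _ _ e); apply: eq_bigr => x _.
by rewrite (endoZ _ _ e); case: e => _ _ ->.
Qed.

(** Infinite series cause no difficulty: the decomposition by first arrows is a finite sum, and it
    makes chi solve the recursion of the identity. *)
Lemma endo_id chi : endo chi -> (forall a, chi (ar R a) = ar R a) ->
  forall f, chi f = f.
Proof.
move=> e chia; apply: (rec_unique (E := @cst R Q) (step := @der R Q) (y := @ar
  R Q)).
- by [].
- move=> f; rewrite {1}[f]series_decomp (endoD _ _ e) (endo_cst _ e).
  rewrite (endo_sum _ _ _ e); congr (_ + _); apply: eq_bigr => a _.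
  by case: e => _ -> _ _; rewrite chia.
by move=> f; rewrite -series_decomp.
Qed.

Lemma endo_comp chi psi : endo chi -> endo psi -> endo (chi \o psi).
Proof.
move=> [L1 M1 e1 o1] [L2 M2 e2 o2]; split=> [c f h|f h|x|n f fn] /=.
- by rewrite L2 L1.
- by rewrite M2 M1.
- by rewrite e2 e1.
- by apply/o1/o2.
Qed.

Lemma endo_subst g : (forall a, order 1 (g a)) -> endo (subst g).
Proof.
move=> g1; split=> [c f h|f h|x|n f fn].
- by rewrite substD // substZ.
- exact: substM.
- exact: subst_ev.
- exact: subst_order.
Qed.

Lemma endo_comm chi n f : endo chi -> comm n f -> comm n (chi f).
Proof.
move=> e; apply: comm_map => [{}f h|{}f h|]; first exact: endoB.
  exists [:: (chi f, chi h)]; rewrite big_seq1 (endoB _ _ e).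
  by case: e => _ M _ _; rewrite !M.
by case: e => _ _ _ chin h; apply: chin.
Qed.

(** The equation for g' makes [subst g'] send [ar a + g a] back to [ar a], up to end vertices, so
    the composite fixes all arrows. *)
Lemma subst_left_inverse g g' : (forall a, order 1 (g a)) ->
  (forall a, order 1 (g' a)) -> (forall a, g' a = - subst g' (g a)) ->
  cancel (subst g) (subst g').
Proof.
move=> g1 g1' gg'.
have e := endo_comp (endo_subst g1') (endo_subst g1).
move=> f; apply: (endo_id e) => a /=; rewrite subst_ar //.
rewrite !(substM g1') // !(substD g1') !(subst_ev g1') (subst_ar g1').
rewrite -[subst g' (g a)]opprK -gg' imageE mulrDl ar_ev eqxx.
rewrite !mulrDr !mulrDl mulrN mulNr !mulrA ev_ev eqxx ev_ar eqxx ar_ev eqxx.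
by rewrite -[_ * ev R (tgt a) * _]mulrA ev_ev eqxx addrK.
Qed.

(** * Truncated exponential of a derivation *)

Section Exponential.
Variable g : arrow Q -> S.
Hypothesis g2 : forall a, order 2 (g a).

Definition dpow n f : S := (n`!%:R)^-1 *: iter n (xi g) f.

Lemma dpow0 f : dpow 0 f = f.
Proof. by rewrite /dpow fact0 invr1 scale1r. Qed.

Lemma xi_dpow n f : xi g (dpow n f) = n.+1%:R *: dpow n.+1 f.
Proof.
rewrite xiZ scalerA factS natrM invfM mulrA divff ?mul1r //.
by rewrite pnatr_eq0.
Qed.

Lemma dpow_order k n f : order k f -> order (k + n) (dpow n f).
Proof.
move=> fk; apply: orderZ; elim: n => [|n IH]; first by rewrite addn0.
by rewrite addnS -addn1 /=; apply: xi_order.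
Qed.

Lemma dpowD n f h : dpow n (f + h) = dpow n f + dpow n h.
Proof.
rewrite /dpow -scalerDr; congr (_ *: _); elim: n => //= n ->; exact: xiD.
Qed.

Lemma dpowM n f h :
  dpow n (f * h) = \sum_(0 <= i < n.+1) dpow i f * dpow (n - i) h.
Proof.
elim: n => [|n IH]; first by rewrite big_nat1 !dpow0.
(* Multiply by n+1 and use the Leibniz rule: the weights i and n+1-i coming from the two factors add
   up to n+1. *)
have n0 : n.+1%:R != 0 :> R[i] by rewrite pnatr_eq0.
apply: (scalerI n0); rewrite -xi_dpow IH.
rewrite (big_morph (xi g) (xiD g) (xi0 g)).
have -> : \sum_(0 <= i < n.+1) xi g (dpow i f * dpow (n - i) h) =
    \sum_(0 <= i < n.+1) i.+1%:R *: (dpow i.+1 f * dpow (n - i) h) +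
    \sum_(0 <= i < n.+1) (n.+1 - i)%:R *: (dpow i f * dpow (n.+1 - i) h).
  rewrite -big_split; apply: eq_big_nat => i /andP[_ i_n] /=.
  by rewrite xiM !xi_dpow (scaleMl i.+1%:R) (scaleMr (n - i).+1%:R) subSn.
rewrite scaler_sumr [X in X + _ = _](_ : _ =
    \sum_(0 <= i < n.+2) i%:R *: (dpow i f * dpow (n.+1 - i) h)); last first.
  rewrite [RHS]big_nat_recl // scale0r add0r.
  by apply: eq_big_nat => i _; rewrite subSS.
rewrite [X in _ + X = _](_ : _ =
    \sum_(0 <= i < n.+2) (n.+1 - i)%:R *: (dpow i f * dpow (n.+1 - i) h));
      last first.
  by rewrite [RHS]big_nat_recr //= subnn scale0r addr0.
rewrite -big_split; apply: eq_big_nat => i /andP[_ i_n] /=.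
by rewrite -scalerDl -natrD subnKC.
Qed.

Definition texp k f : S := \sum_(0 <= n < k) dpow n f.

Lemma texpD k f h : texp k (f + h) = texp k f + texp k h.
Proof. by rewrite -big_split; apply: eq_bigr => n _; apply: dpowD. Qed.

Lemma dpowZ n c f : dpow n (c *: f) = c *: dpow n f.
Proof.
rewrite /dpow scalerA mulrC -scalerA; congr (_ *: _).
by elim: n => //= n ->; apply: xiZ.
Qed.

Lemma texpZ k c f : texp k (c *: f) = c *: texp k f.
Proof. by rewrite scaler_sumr; apply: eq_bigr => n _; apply: dpowZ. Qed.

Lemma texp0 k : texp k 0 = 0.
Proof. by have := texpZ k 0 0; rewrite !scale0r. Qed.

Lemma texp_sum k (I : Type) (r : seq I) (P : pred I) (F : I -> S) :
  texp k (\sum_(i <- r | P i) F i) = \sum_(i <- r | P i) texp k (F i).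
Proof. exact: (big_morph (texp k) (texpD k) (texp0 k)). Qed.

Lemma texp_ev k x : texp k.+1 (ev R x) = ev R x.
Proof.
rewrite /texp big_nat_recl // dpow0 big1 ?addr0 // => n _.
have -> : dpow n.+1 (ev R x) = dpow n.+1 0 + dpow n.+1 (ev R x) by rewrite
  -dpowD add0r.
rewrite /dpow !iterSr xi_ev xi0 -scalerDr; have -> : iter n (xi g) 0 = 0.
  by elim: n => //= n ->; apply: xi0.
by rewrite addr0 scaler0.
Qed.

(** The two sides differ by products of divided powers with i + j >= k; since g has order 2, each
    application of xi raises the order, so these have order k. *)
Lemma texpM k f h : order k (texp k (f * h) - texp k f * texp k h).
Proof.
rewrite mulr_suml; under [X in _ - X]eq_bigr do rewrite mulr_sumr.
have -> : texp k (f * h) =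
    \sum_(0 <= i < k) \sum_(0 <= j < k - i) dpow i f * dpow j h.
  pose F i j := dpow i f * dpow (j - i) h.
  transitivity (\sum_(0 <= j < k) \sum_(0 <= i < k | (i <= j)%N) F i j).
    apply: eq_big_nat => j /andP[_ jk]; rewrite dpowM.
    rewrite [RHS](big_cat_nat (n := j.+1)) //=.
    rewrite [X in _ = _ + X]big_nat_cond [X in _ = _ + X]big_pred0 ?addr0.
      by rewrite big_nat_cond [RHS]big_nat_cond; apply: eq_bigl => i;
        rewrite /= ltnS; case: leqP.
    by move=> i /=; case: (leqP i j) => ij; rewrite ?andbF // ltnNge ij.
  rewrite (exchange_big_dep_nat xpredT) //=; apply: eq_big_nat => i /andP[_ ik].
  rewrite (big_cat_nat (n := i)) //=; last exact: ltnW.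
  rewrite [X in X + _]big_nat_cond [X in X + _]big_pred0 ?add0r; last first.
    by move=> j /=; case: (leqP i j); rewrite ?andbF // ltnNge => ->.
  have := big_addn 0 k i (leq i) (F i); rewrite add0n => ->.
  rewrite big_nat_cond [RHS]big_nat_cond; apply: eq_big => [j|j _].
    by rewrite leq_addl.
  by rewrite /F addnK.
rewrite -sumrB big_nat_cond; apply: order_sum => i /andP[/andP[_ ik] _].
rewrite [X in _ - X](big_cat_nat (n := k - i)) ?leq_subr //=.
rewrite opprD addrA subrr add0r; apply: orderN.
rewrite big_nat_cond; apply: order_sum => j /andP[/andP[kij _] _].
apply: (@orderW _ _ (i + j)); first by rewrite leq_subLR in kij.
by apply: orderM; apply: (@dpow_order 0).
Qed.

Definition trunc n f : S := fun p => if (plength p < n)%N then f p else 0.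

Lemma trunc_mod n f : order n (f - trunc n f).
Proof.
move=> x w wn; case: (boolP (is_path x w)) => xw; last by rewrite coef_out.
by rewrite coefB !(coef_path _ xw) /trunc /plength /parrows /= wn subrr.
Qed.

Lemma trunc_order n k f : order k f -> order k (trunc n f).
Proof.
move=> fk x w wk; case: (boolP (is_path x w)) => xw; last by rewrite coef_out.
have := fk x w wk; rewrite !(coef_path _ xw) /trunc => ->.
by rewrite if_same.
Qed.

(** The truncation makes the images of arrows polynomial, hence analytic, even for a g that is only
    formal. *)
Definition exp_arrow k a : S := trunc k (texp k (ar R a) - ar R a).

Lemma exp_arrow_order k a : order 2 (exp_arrow k.+1 a).
Proof.
apply: trunc_order; rewrite /texp big_nat_recl // dpow0 addrC addrA addNr add0r.
by apply: order_sum => i _; apply: (@orderW _ _ (1 + i.+1)) => //;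
  apply: dpow_order.
Qed.

(** Being multiplicative modulo order k+1, the truncated exponential satisfies the recursion of
    [subst] up to that order. *)
Lemma subst_exp_arrow k f :
  order k.+1 (subst (exp_arrow k.+1) f - texp k.+1 f).
Proof.
set e := exp_arrow k.+1; have e1 a : order 1 (e a).
  by apply: orderW (exp_arrow_order k a).
apply: (rec_order (P := fun=> True) (step := @der R Q) (y := image e)
  (d := fun f => subst e f - texp k.+1 f)
  (E := fun f => cst f + \sum_a image e a * texp k.+1 (der a f) - texp k.+1 f))
    => //.
- by move=> a; apply: order_image.
- move=> {}f _; rewrite [in texp _ f](series_decomp f) texpD texp_sum.
  have -> : texp k.+1 (cst f) = cst f.
    rewrite cstE texp_sum; apply: eq_bigr => x _.
    by rewrite texpZ texp_ev.
  rewrite opprD addrACA subrr add0r -sumrB; apply: order_sum => a _.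
  apply: (@order_trans _ _ _ (texp k.+1 (ar R a) * texp k.+1 (der a f))).
    rewrite -mulrBl; apply: orderMr.
    apply: (@order_trans _ _ _ (ev R (src a) * texp k.+1 (ar R a))).
      rewrite -mulrBr; apply: orderMl.
      rewrite -[texp _ _ in X in _ - X](subrK (ar R a)) [_ - _ + _]addrC opprD.
      rewrite addrACA subrr add0r; apply: order_sym; exact: trunc_mod.
    have := @texpM k.+1 (ev R (src a)) (ar R a); rewrite ev_ar eqxx texp_ev.
    exact: order_sym.
  by apply: order_sym; apply: texpM.
move=> {}f _; rewrite (substE e1 f).
under [X in _ = _ + X]eq_bigr do rewrite mulrBr.
rewrite sumrB [RHS]addrC [cst f + _ in RHS]addrC !addrA subrK.
by rewrite [_ + cst f]addrC.
Qed.

End Exponential.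
End AdicSubstitution.

(** * Weighted norms *)

Section WeightedNorm.
Variables (R : realType) (Q : quiver).
Notation S := (series R Q).
Notation nc := (@normc R).
Implicit Types (f h : S) (x : vertex Q) (a b : arrow Q) (rho : R).
Implicit Types (w v : seq (arrow Q)) (n k s d : nat) (g : arrow Q -> S).

Lemma nc_ge0 (z : R[i]) : 0 <= nc z.
Proof. by case: z => *; apply: sqrtr_ge0. Qed.
Hint Resolve nc_ge0 : core.

Lemma norm_ncE (z : R[i]) : `|z| = ((nc z)%:C)%C.
Proof. by rewrite normc_def; case: z. Qed.

(* The sum of [|f w| * rho ^+ size w] over the paths w of length < n. *)
Fixpoint wnorm rho n f : R :=
  if n is n'.+1 then
    \sum_x nc (c0 f x) + rho * \sum_a wnorm rho n' (der a f)
  else 0.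

Lemma wnorm_ge0 rho n f : 0 <= rho -> 0 <= wnorm rho n f.
Proof.
move=> r0; elim: n f => // n IH f /=.
by rewrite addr_ge0 ?mulr_ge0 ?sumr_ge0.
Qed.

Lemma wnorm0 rho n : wnorm rho n 0 = 0.
Proof.
elim: n => // n IH /=; rewrite big1 => [|x _]; last by rewrite c00 normc0.
by rewrite big1 ?mulr0 ?addr0 // => a _; rewrite der0.
Qed.

Lemma wnormD rho n f h : 0 <= rho ->
  wnorm rho n (f + h) <= wnorm rho n f + wnorm rho n h.
Proof.
move=> r0; elim: n f h => [|n IH] f h /=; first by rewrite addr0.
rewrite addrACA -mulrDr -!big_split lerD ?ler_wpM2l ?ler_sum // => [x _|a _].
  by rewrite c0D le_normcD.
by rewrite derD.
Qed.

Lemma wnormN rho n f : wnorm rho n (- f) = wnorm rho n f.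
Proof.
elim: n f => // n IH f /=; congr (_ + _ * _).
  by apply: eq_bigr => x _; rewrite -sub0r c0B c00 sub0r normcN.
by apply: eq_bigr => a _; rewrite -sub0r derB der0 sub0r.
Qed.

Lemma wnormB rho n f h : 0 <= rho ->
  wnorm rho n (f - h) <= wnorm rho n f + wnorm rho n h.
Proof. by move=> r0; rewrite -(wnormN _ _ h); apply: wnormD. Qed.

Lemma wnorm_sum rho n (I : Type) (r : seq I) (P : pred I) (F : I -> S) :
  0 <= rho -> wnorm rho n (\sum_(i <- r | P i) F i) <=
    \sum_(i <- r | P i) wnorm rho n (F i).
Proof.
move=> r0; elim/big_rec2: _ => [|i u f _ fu]; first by rewrite wnorm0.
by apply: le_trans (wnormD _ _ _ r0) _; rewrite lerD2l.
Qed.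

Lemma wnormZ rho n c f : wnorm rho n (c *: f) = nc c * wnorm rho n f.
Proof.
elim: n f => [|n IH] f /=; first by rewrite mulr0.
rewrite mulrDr mulrCA; congr (_ + _ * _); rewrite mulr_sumr.
  by apply: eq_bigr => x _; rewrite c0Z normcM.
by apply: eq_bigr => a _; rewrite derZ IH.
Qed.

Lemma wnormS rho n f : 0 <= rho -> wnorm rho n f <= wnorm rho n.+1 f.
Proof.
move=> r0; elim: n f => [|n IH] f; first exact: wnorm_ge0.
by rewrite [leRHS]/= lerD2l ler_wpM2l // ler_sum.
Qed.

Lemma wnorm_order rho n f : order n f -> wnorm rho n f = 0.
Proof.
elim: n f => // n IH f fn /=.
rewrite big1 => [|x _]; last by rewrite (order_c0 x fn) normc0.
by rewrite big1 ?mulr0 ?addr0 // => a _; apply: IH; exact: order_der fn.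
Qed.

Lemma wnorm_mod rho n f h : 0 <= rho -> order n (f - h) ->
  wnorm rho n f <= wnorm rho n h.
Proof.
move=> r0 fh; rewrite -{1}(subrK h f); apply: le_trans (wnormD _ _ _ r0) _.
by rewrite wnorm_order // add0r.
Qed.

Lemma wnorm_c0 rho n f x : 0 <= rho -> nc (c0 f x) <= wnorm rho n.+1 f.
Proof.
move=> r0 /=; rewrite (bigD1 x) //= -addrA lerDl addr_ge0 ?sumr_ge0 //.
by rewrite mulr_ge0 ?sumr_ge0 // => a _; apply: wnorm_ge0.
Qed.

Lemma wnorm_der rho n a f : 0 <= rho ->
  rho * wnorm rho n (der a f) <= wnorm rho n.+1 f.
Proof.
move=> r0 /=; rewrite (bigD1 a) //= mulrDr addrCA lerDl addr_ge0 ?sumr_ge0 //.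
by rewrite mulr_ge0 ?sumr_ge0 // => b _; apply: wnorm_ge0.
Qed.

Lemma wnormM rho n f h : 0 <= rho ->
  wnorm rho n (f * h) <= wnorm rho n f * wnorm rho n h.
Proof.
move=> r0; elim: n f h => [|n IH] f h; first by rewrite mulr0.
apply: (@le_trans _ _ (\sum_x nc (c0 f x) * wnorm rho n.+1 h +
    rho * \sum_a wnorm rho n (der a f) * wnorm rho n.+1 h)); last first.
  by rewrite -!mulr_suml mulrA -mulrDl.
rewrite [leLHS]/=.
apply: (@le_trans _ _ (\sum_x nc (c0 f x) * nc (c0 h x) + rho * \sum_a
    (wnorm rho n (der a f) * wnorm rho n h +
     nc (c0 f (src a)) * wnorm rho n (der a h)))).
  rewrite lerD //; first by apply: ler_sum => x _; rewrite c0M normcM.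
  rewrite ler_wpM2l //; apply: ler_sum => a _; rewrite derM.
  by apply: le_trans (wnormD _ _ _ r0) _; rewrite wnormZ lerD2r.
rewrite big_split /= mulrDr addrCA addrC lerD //; last first.
  rewrite ler_wpM2l //; apply: ler_sum => a _.
  by rewrite ler_wpM2l ?wnorm_ge0 ?wnormS.
under [leRHS]eq_bigr do rewrite /= mulrDr.
rewrite big_split /= lerD //.
  apply: ler_sum => x _; rewrite ler_wpM2l // (bigD1 x) //= lerDl.
  by rewrite sumr_ge0.
under [leRHS]eq_bigr do rewrite mulrCA mulr_sumr.
rewrite -mulr_sumr ler_wpM2l // exchange_big /=; apply: ler_sum => a _.
rewrite (bigD1 (src a)) //= lerDl sumr_ge0 // => x _.
by rewrite mulr_ge0 // wnorm_ge0.
Qed.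

(** The first factor uses up at least one degree, so h is measured at n only; this is what lets the
    later inductions on n close. *)
Lemma wnormM_order1 rho n f h : 0 <= rho -> order 1 f ->
  wnorm rho n.+1 (f * h) <= wnorm rho n.+1 f * wnorm rho n h.
Proof.
move=> r0 f1 /=; rewrite big1 => [|x _]; last first.
  by rewrite c0M (order_c0 x f1) mul0r normc0.
rewrite [\sum_x nc (c0 f x)]big1 => [|x _];
  last by rewrite (order_c0 x f1) normc0.
rewrite !add0r -mulrA mulr_suml ler_wpM2l //; apply: ler_sum => a _.
by rewrite derM (order_c0 (src a) f1) scale0r addr0 wnormM.
Qed.

Lemma wnorm_ev rho n x : 0 <= rho -> wnorm rho n (ev R x) <= 1.
Proof.
move=> r0; case: n => //= n; rewrite (bigD1 x) //= c0_ev eqxx normc1.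
rewrite big1 => [|y yx]; last by rewrite c0_ev (negPf yx) normc0.
by rewrite big1 ?mulr0 ?addr0 // => a _; rewrite der_ev wnorm0.
Qed.

Lemma wnorm_ar rho n a : 0 <= rho -> wnorm rho n (ar R a) <= rho.
Proof.
move=> r0; case: n => //= n; rewrite big1 => [|x _];
  last by rewrite c0_ar normc0.
rewrite add0r (bigD1 a) //= big1 => [|b ba]; rewrite der_ar; last first.
  by rewrite (negPf ba) wnorm0.
by rewrite eqxx addr0 ler_piMr // wnorm_ev.
Qed.

Lemma wnorm1 rho n : 0 <= rho -> wnorm rho n 1 <= #|vertex Q|%:R.
Proof.
move=> r0; rewrite -(sum_ev R Q); apply: le_trans (wnorm_sum _ _ _ _ r0) _.
rewrite -sumr_const; apply: ler_sum => x _; exact: wnorm_ev.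
Qed.

Lemma wnorm_evM rho n x f : 0 <= rho ->
  wnorm rho n (ev R x * f) <= wnorm rho n f.
Proof.
move=> r0; apply: le_trans (wnormM _ _ _ r0) _.
by rewrite ler_piMl ?wnorm_ge0 ?wnorm_ev.
Qed.

Lemma wnorm_le rho rho' n f : 0 <= rho -> rho <= rho' ->
  wnorm rho n f <= wnorm rho' n f.
Proof.
move=> r0 rr'; elim: n f => // n IH f /=; rewrite lerD2l ler_pM ?ler_sum //.
by rewrite sumr_ge0 // => a _; apply: wnorm_ge0.
Qed.

Lemma wnorm_scale rho rho' n k f : 0 <= rho -> 0 < rho' -> rho <= rho' ->
  order k f -> wnorm rho n f <= (rho / rho') ^+ k * wnorm rho' n f.
Proof.
move=> r0 r0' rr'; have r0'' := ltW r0'.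
have q0 : 0 <= rho / rho' by rewrite divr_ge0.
elim: k n f => [|k IH] [|n] f fk; rewrite ?mulr0 //.
  by rewrite expr0 mul1r wnorm_le.
rewrite /= [\sum_x nc (c0 f x)]big1 => [|x _]; last first.
  by rewrite (order_c0 x fk) normc0.
rewrite !add0r.
rewrite exprS mulrACA divfK ?gt_eqF // ler_wpM2l // mulr_sumr.
by apply: ler_sum => a _; apply: IH; exact: order_der fk.
Qed.

(** Uniformity in n expresses that the full weighted sum converges with value at most B. *)
Definition wbounded rho f B := forall n, wnorm rho n f <= B.

(** From each vertex start at most [#|arrow Q| ^ l] words of length l, so the norm is dominated by a
    geometric series of ratio at most 1/2, whence the factor 2. *)
Lemma coef_wbounded f M C rho : 0 <= M -> 0 <= C -> 0 <= rho ->
  rho * C * #|arrow Q|%:R <= 2^-1 ->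
  (forall x w, nc (coef f x w) <= M * C ^+ size w) ->
  wbounded rho f (2 * #|vertex Q|%:R * M).
Proof.
move=> M0 C0 r0 rC fM n; have V0 : 0 <= #|vertex Q|%:R :> R by [].
elim: n f M M0 fM => [|n IH] f M M0 fM /=; first by rewrite !mulr_ge0.
have -> : 2 * #|vertex Q|%:R * M = #|vertex Q|%:R * M + #|vertex Q|%:R * M by
  ring.
rewrite lerD //.
  rewrite mulr_natl -sumr_const; apply: ler_sum => x _.
  by have := fM x [::]; rewrite expr0 mulr1.
apply: (@le_trans _ _ (rho * (#|arrow Q|%:R * (2 * #|vertex Q|%:R * (M * C))))).
  rewrite ler_wpM2l // mulr_natl -sumr_const; apply: ler_sum => a _.
  apply: IH; first exact: mulr_ge0.
  move=> x w; rewrite coef_der; case: eqP => _.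
    by have := fM (src a) (a :: w); rewrite /= exprS mulrA.
  by rewrite normc0 !mulr_ge0 ?exprn_ge0.
have -> : rho * (#|arrow Q|%:R * (2 * #|vertex Q|%:R * (M * C))) =
  (rho * C * #|arrow Q|%:R) * (2 * #|vertex Q|%:R * M) by ring.
have -> : #|vertex Q|%:R * M = 2^-1 * (2 * #|vertex Q|%:R * M) by field.
by rewrite ler_wpM2r // !mulr_ge0.
Qed.

Lemma wnorm_coef rho f x w : 0 <= rho ->
  nc (coef f x w) * rho ^+ size w <= wnorm rho (size w).+1 f.
Proof.
move=> r0; elim: w x f => [|a w IH] x f; first by rewrite mulr1;
  apply: wnorm_c0.
have [->|xa] := eqVneq x (src a); last first.
  rewrite (@coef_out _ _ f x (a :: w)); last by rewrite /= eq_sym (negPf xa).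
  by rewrite normc0 mul0r wnorm_ge0.
apply: le_trans (wnorm_der _ a f r0); rewrite exprS mulrCA ler_wpM2l //.
by have := IH (tgt a) (der a f); rewrite coef_der eqxx.
Qed.

Lemma analytic_wbounded f : is_analytic f ->
  exists rho B, [/\ 0 < rho, 0 <= B & wbounded rho f B].
Proof.
move=> /analyticP[[M C] /= [M1 C1] fb].
have M0 : 0 <= M := le_trans ler01 M1; have C0 : 0 < C := lt_le_trans ltr01 C1.
exists (2 * C * (1 + #|arrow Q|%:R))^-1, (2 * #|vertex Q|%:R * M).
have A0 : 0 <= #|arrow Q|%:R :> R by [].
have A1 : 0 < 1 + #|arrow Q|%:R :> R by rewrite ltr_wpDr.
split; [by rewrite invr_gt0 !mulr_gt0|by rewrite !mulr_ge0|].
apply: (@coef_wbounded _ _ C);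
  rewrite ?invr_ge0 ?mulr_ge0 ?(ltW C0) ?(ltW A1) //.
  have -> : (2 * C * (1 + #|arrow Q|%:R))^-1 * C * #|arrow Q|%:R =
      2^-1 * (#|arrow Q|%:R / (1 + #|arrow Q|%:R)).
    by field; rewrite !gt_eqF.
  by rewrite ler_piMr ?invr_ge0 // ler_pdivrMr // mul1r lerDr.
move=> x w; have := coef_bound x w M0 (ltW C0) fb.
by rewrite norm_ncE lecR.
Qed.

Lemma wbounded_analytic f rho B : 0 < rho -> wbounded rho f B -> is_analytic f.
Proof.
move=> r0 fB; have B0 : 0 <= B by apply: le_trans (fB 0); apply/wnorm_ge0/ltW.
apply: (@analytic_bound _ _ _ B rho^-1); rewrite ?invr_ge0 ?(ltW r0) // => p.
rewrite norm_ncE lecR -coefP exprVn ler_pdivlMr ?exprn_gt0 //.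
by apply: le_trans (wnorm_coef _ _ _ (ltW r0)) _.
Qed.

Lemma wbounded_le rho rho' f B B' : 0 <= rho -> rho <= rho' -> B <= B' ->
  wbounded rho' f B -> wbounded rho f B'.
Proof.
by move=> r0 rr' BB' fB n;
  apply: le_trans (wnorm_le _ _ r0 rr') (le_trans (fB n) BB').
Qed.

Lemma wbounded_scale rho rho' k f B : 0 <= rho -> 0 < rho' -> rho <= rho' ->
  order k f -> wbounded rho' f B -> wbounded rho f ((rho / rho') ^+ k * B).
Proof.
move=> r0 r0' rr' fk fB n; apply: le_trans (wnorm_scale _ r0 r0' rr' fk) _.
by rewrite ler_wpM2l // exprn_ge0 // divr_ge0 // ltW.
Qed.

Lemma wbounded_limit rho B u f : 0 <= rho -> (forall k, order k (f - u k)) ->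
  (forall k, wbounded rho (u k) B) -> wbounded rho f B.
Proof.
by move=> r0 fu uB n; apply: le_trans (wnorm_mod r0 (fu n)) (uB n n).
Qed.

(** * Norm estimates for substitutions *)

Section SubstitutionBounds.
Variables (g : arrow Q -> S) (rho eps : R).
Hypotheses (rho0 : 0 < rho) (eps0 : 0 <= eps).
Hypothesis g1 : forall a, order 1 (g a).
Hypothesis g_eps : forall a, wbounded rho (g a) eps.

Let r0 : 0 <= rho := ltW rho0.

Lemma wnorm_image n a : wnorm rho n (image g a) <= rho + eps.
Proof.
apply: le_trans (wnorm_evM _ _ _ r0) _; apply: le_trans (wnormD _ _ _ r0) _.
by rewrite lerD ?wnorm_ar //; apply: g_eps.
Qed.

(** An arrow, of weight [rho + eps] on the right, is replaced by a series of norm at most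
    [rho + eps]. *)
Lemma wnorm_subst n f : wnorm rho n (subst g f) <= wnorm (rho + eps) n f.
Proof.
elim: n f => // n IH f; rewrite substE //; apply: le_trans (wnormD _ _ _ r0) _.
rewrite [leRHS]/= lerD //.
  rewrite /= [X in _ + _ * X]big1 => [|a _]; last first.
    by rewrite cstE der_sum big1 ?wnorm0 // => x _; rewrite derZ der_ev scaler0.
  rewrite mulr0 addr0; apply: ler_sum => x _; rewrite cstE c0_sum (bigD1 x) //=.
  rewrite c0Z c0_ev eqxx mulr1 big1 ?addr0 // => y yx.
  by rewrite c0Z c0_ev eq_sym (negPf yx) mulr0.
apply: le_trans (wnorm_sum _ _ _ _ r0) _; rewrite mulr_sumr.
apply: ler_sum => a _; apply: le_trans (wnormM_order1 _ _ r0 _) _.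
  exact: order_image.
by rewrite ler_pM ?wnorm_ge0 ?wnorm_image.
Qed.

Hypothesis eps_rho : eps <= rho.

Lemma wnorm_subst2 n f : wnorm rho n (subst g f) <= wnorm (2 * rho) n f.
Proof.
apply: le_trans (wnorm_subst _ _) _; apply: wnorm_le; first exact: addr_ge0.
by rewrite mulrDl mul1r lerD2l.
Qed.

(** A mean value estimate, modelled on (rho + eps)^l - rho^l <= (eps / rho) (2 rho)^l. Doubling the
    radius pays for the two sums of the recursion: first arrow replaced, or kept. *)
Lemma wnorm_subst_sub n f :
  rho * wnorm rho n (subst g f - f) <= eps * wnorm (2 * rho) n f.
Proof.
have r20 : 0 <= 2 * rho by rewrite mulr_ge0.
elim: n f => [|n IH] f; first by rewrite !mulr0.
apply: (@le_trans _ _ (eps * (2 * rho * \sum_a wnorm (2 * rho) n (der a f)))).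
  have -> : eps * (2 * rho * \sum_a wnorm (2 * rho) n (der a f)) =
     rho * (eps * \sum_a wnorm (2 * rho) n (der a f) +
            eps * \sum_a wnorm (2 * rho) n (der a f)) by ring.
  rewrite subst_subE // ler_wpM2l //.
  apply: le_trans (wnormD _ _ _ r0) _; apply: lerD.
    apply: le_trans (wnorm_sum _ _ _ _ r0) _; rewrite mulr_sumr.
    apply: ler_sum => a _; apply: le_trans (wnormM_order1 _ _ r0 _) _.
      exact: orderMl.
    rewrite ler_pM ?wnorm_ge0 ?wnorm_subst2 //.
    by apply: le_trans (wnorm_evM _ _ _ r0) _; apply: g_eps.
  apply: le_trans (wnorm_sum _ _ _ _ r0) _; rewrite mulr_sumr.
  apply: ler_sum => a _; apply: le_trans (wnormM_order1 _ _ r0 _) _ => //.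
  apply: le_trans (IH _); rewrite ler_wpM2r ?wnorm_ge0 ?wnorm_ar //.
by rewrite ler_wpM2l //= lerDr sumr_ge0.
Qed.

(** The same scheme one order higher: the sum with a replaced first arrow is controlled by
    [wnorm_subst_sub], which supplies the second factor eps. *)
Lemma wnorm_remainder n f :
  rho ^+ 2 * wnorm rho n (remainder g f) <= eps ^+ 2 * wnorm (2 * rho) n f.
Proof.
have r20 : 0 <= 2 * rho by rewrite mulr_ge0.
elim: n f => [|n IH] f; first by rewrite !mulr0.
apply: (@le_trans _ _ (eps ^+ 2 * (2 * rho * \sum_a wnorm (2 * rho) n (der a
  f)))).
  have -> : eps ^+ 2 * (2 * rho * \sum_a wnorm (2 * rho) n (der a f)) =
     rho * (eps * (eps * \sum_a wnorm (2 * rho) n (der a f)) +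
            eps ^+ 2 * \sum_a wnorm (2 * rho) n (der a f)) by ring.
  rewrite remainderE // expr2 -mulrA ler_wpM2l //.
  apply: le_trans (_ : rho * (_ + _) <= _).
    rewrite ler_wpM2l //; exact: wnormD.
  rewrite mulrDr; apply: lerD.
    rewrite mulr_sumr.
    apply: (@le_trans _ _ (rho * \sum_a eps * wnorm rho n (subst g (der a f) -
      der a f))).
      rewrite ler_wpM2l //; apply: le_trans (wnorm_sum _ _ _ _ r0) _.
      apply: ler_sum => a _; apply: le_trans (wnormM_order1 _ _ r0 _) _.
        exact: orderMl.
      rewrite ler_wpM2r ?wnorm_ge0 //.
      by apply: le_trans (wnorm_evM _ _ _ r0) _; apply: g_eps.
    rewrite !mulr_sumr; apply: ler_sum => a _.
    by rewrite mulrCA ler_wpM2l // wnorm_subst_sub.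
  apply: (@le_trans _ _ (rho * \sum_a rho * wnorm rho n (remainder g (der a
    f)))).
    rewrite ler_wpM2l //; apply: le_trans (wnorm_sum _ _ _ _ r0) _.
    apply: ler_sum => a _; apply: le_trans (wnormM_order1 _ _ r0 _) _ => //.
    by rewrite ler_wpM2r ?wnorm_ge0 ?wnorm_ar.
  by rewrite !mulr_sumr; apply: ler_sum => a _; rewrite mulrA -expr2.
by rewrite ler_wpM2l ?exprn_ge0 //= lerDr sumr_ge0.
Qed.

End SubstitutionBounds.

(** Again a geometric series of ratio at most 1/2, now over the words v in front of h. *)
Lemma wnorm_bil rho A M C h n : 0 <= rho -> 0 <= M -> 0 <= C ->
  rho * C * #|arrow Q|%:R <= 2^-1 ->
  (forall x v, wbounded rho (A x v) (M * C ^+ size v)) ->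
  wnorm rho n (bil A h) <= 2 * #|vertex Q|%:R * M * wnorm rho n h.
Proof.
move=> r0 M0 C0 rC; have V0 : 0 <= #|vertex Q|%:R :> R by [].
elim: n A M M0 => [|n IH] A M M0 AM; first by rewrite mulr0.
have -> : 2 * #|vertex Q|%:R * M * wnorm rho n.+1 h =
  #|vertex Q|%:R * (M * wnorm rho n.+1 h) +
  2^-1 * (2 * #|vertex Q|%:R * M * wnorm rho n.+1 h) by field.
rewrite bilE; apply: le_trans (wnormD _ _ _ r0) _; apply: lerD.
  apply: le_trans (wnorm_sum _ _ _ _ r0) _; rewrite mulr_natl -sumr_const.
  apply: ler_sum => x _; apply: le_trans (wnormM _ _ _ r0) _.
  rewrite mulrC ler_pM ?wnorm_ge0 ?wnorm_evM //.
  by have := AM x [::] n.+1; rewrite mulr1.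
apply: le_trans (wnorm_sum _ _ _ _ r0) _.
apply: (@le_trans _ _ (\sum_(b : arrow Q) rho *
    (2 * #|vertex Q|%:R * (M * C) * wnorm rho n.+1 h))).
  apply: ler_sum => b _; apply: le_trans (wnormM_order1 _ _ r0 _) _ => //.
  rewrite ler_pM ?wnorm_ge0 ?wnorm_ar //.
  apply: le_trans (_ : 2 * #|vertex Q|%:R * (M * C) * wnorm rho n h <= _).
    apply: IH; first exact: mulr_ge0.
    by move=> x v m; have := AM (src b) (b :: v) m; rewrite /= exprS mulrA.
  by rewrite ler_wpM2l ?wnormS // !mulr_ge0.
set t := rho * (2 * _ * _ * _).
have -> : \sum_(b : arrow Q) t = #|arrow Q|%:R * t by rewrite mulr_natl
  -sumr_const.
rewrite {}/t; have -> : #|arrow Q|%:R * (rho * (2 * #|vertex Q|%:R * (M * C) *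
  wnorm rho n.+1 h)) =
  rho * C * #|arrow Q|%:R * (2 * #|vertex Q|%:R * M * wnorm rho n.+1 h) by ring.
by rewrite ler_wpM2r // !mulr_ge0 // wnorm_ge0.
Qed.

End WeightedNorm.

(** * The Jacobi ideal *)

Section JacobiSeries.
Variables (R : realType) (Q : quiver).
Notation S := (series R Q).
Notation nc := (@normc R).
Implicit Types (f h X F : S) (x y : vertex Q) (a b : arrow Q) (rho : R).
Implicit Types (w v s : seq (arrow Q)) (n k d : nat) (g : arrow Q -> S).

(** Groups the coefficients by the right-hand path, so that the sum over left-hand paths becomes a
    series. *)
Definition fam (G : qpath Q -> qpath Q -> R[i]) : vertex Q -> seq (arrow Q) ->
  S :=
  fun y v u => if insub (y, v) is Some q then G u q else 0.

Lemma is_path_take x w i : is_path x w -> is_path x (take i w).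
Proof. by rewrite -{1}(cat_take_drop i w) is_path_cat => /andP[]. Qed.

Lemma is_path_drop x w i : is_path x w ->
  is_path (endpoint x (take i w)) (drop i w).
Proof. by rewrite -{1}(cat_take_drop i w) is_path_cat => /andP[]. Qed.

Lemma coef_Msuffix f x w j (p : is_path (endpoint x (take j w)) (drop j w)) :
  (j <= size w)%N ->
  coef (f * monomial R (@QPath Q (_, _) p)) x w = coef f x (take j w).
Proof.
move=> jw; have jw' : (j < (size w).+1)%N by [].
rewrite coefM (bigD1 (Ordinal jw')) //= coef_monomial eqxx mulr1.
rewrite big1 ?addr0 // => k kj;
  rewrite coef_monomial [_ == _](_ : _ = false) ?mulr0 //.
apply: contraNF kj => /eqP[_ /(congr1 size)]; rewrite !size_drop => E.
have kw : (k <= size w)%N by rewrite -ltnS.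
by apply/eqP/val_inj; rewrite /= -[LHS](subKn kw) -[RHS](subKn jw) E.
Qed.

Lemma coef_prefixM f x w i j (p : is_path x (take i w)) :
  (i <= size w)%N -> (j <= size w)%N ->
  coef (monomial R (@QPath Q (_, _) p) * f) x (take j w) =
  if (i <= j)%N then coef f (endpoint x (take i w)) (drop i (take j w)) else 0.
Proof.
move=> iw jw; rewrite coefM size_takel //; case: leqP => ij; last first.
  rewrite big1 // => k _; rewrite coef_monomial [_ == _](_ : _ = false) ?mul0r
    //.
  have kj : (k <= j)%N by rewrite -ltnS.
  apply/eqP => -[/(congr1 size)]; rewrite take_takel // !size_takel //.
    by move=> E; move: ij; rewrite E ltnNge kj.
  exact: leq_trans kj jw.
have ij' : (i < j.+1)%N by [].
rewrite (bigD1 (Ordinal ij')) //= take_takel // coef_monomial eqxx mul1r.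
rewrite big1 ?addr0 // => k ki;
  rewrite coef_monomial [_ == _](_ : _ = false) ?mul0r //.
have kj : (k <= j)%N by rewrite -ltnS.
apply: contraNF ki => /eqP[/(congr1 size)];
  rewrite take_takel // !size_takel //.
  by move=> E; apply/eqP/val_inj.
exact: leq_trans kj jw.
Qed.

Lemma jacobi_sum_coef (G : qpath Q -> qpath Q ->
  R[i]) X x w (xw : is_path x w) :
  \sum_(uv \in [set: qpath Q * qpath Q])
     G uv.1 uv.2 * (monomial R uv.1 * X * monomial R uv.2) (@QPath Q (x,
       w) xw) =
  \sum_(j < (size w).+1)
     coef (fam G (endpoint x (take j w)) (drop j w) * X) x (take j w).
Proof.
(* Only a prefix and a suffix of w can contribute; i and j are the two cuts, and pairs with i > j
   overlap and give 0. *)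
pose P i := @QPath Q (x, take i w) (is_path_take i xw).
pose T j := @QPath Q (endpoint x (take j w), drop j w) (is_path_drop j xw).
pose I := iota 0 (size w).+1; pose r := [seq (P i, T j) | j <- I, i <- I].
have Iw i : i \in I -> (i <= size w)%N by rewrite mem_iota.
have r_uniq : uniq r.
  apply: allpairs_uniq; rewrite ?iota_uniq //.
  move=> [j i] [j' i'] /allpairsP[[? ?] [/Iw jw /Iw iw [-> ->]]].
  move=> /allpairsP[[? ?] [/Iw jw' /Iw iw' [-> ->]]] /=.
  case=> /(congr1 size) + _ /(congr1 size).
  rewrite !size_takel // !size_drop => -> E; congr (_, _).
  by rewrite -[LHS](subKn jw) -[RHS](subKn jw') E.
rewrite (fsbigE r) //=; last first.
  move=> [u v] _; apply: contraNeq; rewrite mulf_eq0 negb_or => /andP[_ /=].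
  rewrite -coefP /pstart /parrows /= => /coef_mul_neq0[j jw []].
  move=> /coef_mul_neq0[i ij [/coef_monomial_neq0 uE _]] /coef_monomial_neq0 vE.
  have ijw : (i <= j)%N by rewrite size_takel in ij.
  apply/allpairsP; exists (j, i); split => /=; rewrite ?mem_iota //=.
    by rewrite add0n ltnS (leq_trans ijw).
  by congr (_, _); apply: val_inj => /=; rewrite ?uE ?vE ?take_takel.
under eq_bigl do rewrite in_setT.
rewrite big_allpairs_dep /= -[in RHS](big_mkord xpredT (fun j =>
  coef (fam G (endpoint x (take j w)) (drop j w) * X) x (take j w))).
have IE : I = index_iota 0 (size w).+1 by rewrite /index_iota subn0.
rewrite {1}IE; apply: eq_big_nat => j /andP[_]; rewrite ltnS => jw.
rewrite coefM size_takel //.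
transitivity (\sum_(i < (size w).+1) if (i <= j)%N then G (P i) (T j) *
    coef X (endpoint x (take i w)) (drop i (take j w)) else 0).
  rewrite -(big_mkord xpredT (fun i => if (i <= j)%N then G (P i) (T j) *
    coef X (endpoint x (take i w)) (drop i (take j w)) else 0)).
  rewrite IE; apply: eq_big_nat => i /andP[_]; rewrite ltnS => iw.
  rewrite -(coefP (_ * _)) /pstart /parrows /= /T /P coef_Msuffix //
    coef_prefixM //.
  by case: ifP; rewrite ?mulr0.
rewrite -big_mkcond (big_ord_widen_cond (size w).+1 xpredT (fun i =>
  coef (fam G (endpoint x (take j w)) (drop j w)) x (take i (take j w)) *
  coef X (endpoint x (take i (take j w))) (drop i (take j w)))) //=.
apply: eq_big => [i|i ij]; first by rewrite ltnS.
rewrite take_takel // (coef_path _ (is_path_take i xw)) /fam.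
case: insubP => [q _ qE|]; last by rewrite /= is_path_drop.
by congr (G _ _ * _); apply: val_inj; rewrite qE.
Qed.

(** The form of ideal membership used from here on: the bound holds from length 0, and the double
    sum is replaced by finite truncations to which [bil_jsum] applies. *)
Definition is_jac F f := exists A : arrow Q -> vertex Q -> seq (arrow Q) -> S,
  (exists M C : R, [/\ 0 <= M, 0 <= C & forall a y v z u,
     nc (coef (A a y v) z u) <= M * C ^+ (size v + size u)]) /\
  forall n, order n (f - \sum_a jsum n (A a) (cyclic_derivative a F)).

Lemma short_pairs_bounded (G : qpath Q -> qpath Q -> R[i]) n :
  exists2 M : R, 0 <= M & forall p q, (plength p < n)%N -> (plength q < n)%N ->
    nc (G p q) <= M.
Proof.
have bd q : exists M : R, 0 <= M /\ forall p, (plength p < n)%N ->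
  nc (G p q) <= M.
  have [M M0 GM] := short_bounded (fun p => G p q) n; exists M; split=> // u un.
  by have := GM u un; rewrite norm_ncE lecR.
have [B HB] := choice bd.
have [M M0 BM] := short_bounded (fun q => ((B q)%:C)%C) n;
  exists M => // u q un vn.
have [Bv0 GB] := HB q; apply: le_trans (GB u un) _.
by have := BM q vn; rewrite ger0_norm ?lecR //= (lecR 0).
Qed.

Lemma jacobi_ideal_is_jac (Phi : potential R Q) (f : analytic R Q) :
  jacobi_ideal Phi f -> is_jac (representative Phi) f.
Proof.
move=> [G [[C [C0 [N GC]]] fE]]; exists (fun a => fam (G a)); split; last first.
  move=> n x w wn; case: (boolP (is_path x w)) => xw; last by rewrite coef_out.
  rewrite coefB coef_sum (coef_path _ xw) fE; apply/eqP; rewrite subr_eq0;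
    apply/eqP.
  by apply: eq_bigr => a _; rewrite jacobi_sum_coef coef_jsum_full.
have bd a : exists M : R, 0 <= M /\ forall p q,
    (plength p < N)%N -> (plength q < N)%N -> nc (G a p q) <= M.
  by have [M M0 GM] := short_pairs_bounded (G a) N; exists M.
have [B HB] := choice bd.
have B0 : 0 <= \sum_a B a by apply: sumr_ge0 => a _; case: (HB a).
have C1 m : 1 <= (1 + C) ^+ m by rewrite exprn_ege1 // lerDl ltW.
exists (1 + \sum_a B a), (1 + C); split; rewrite ?addr_ge0 ?(ltW C0) //.
move=> a y v z u; have pos : 0 <= (1 + \sum_a B a) * (1 + C) ^+ (size v + size
  u).
  by rewrite mulr_ge0 ?addr_ge0 ?exprn_ge0 ?addr_ge0 ?(ltW C0).
case: (boolP (is_path z u)) => zu; last by rewrite coef_out // normc0.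
rewrite (coef_path _ zu) /fam; case: insubP => [q _ qE|_];
  last by rewrite normc0.
have qv : plength q = size v by rewrite /plength /parrows qE.
set p := @QPath Q (z, u) zu; have pu : plength p = size u by [].
rewrite -qv -pu; case: (leqP N (plength q + plength p)) => [Nqp|qpN].
  have := GC a p q; rewrite addnC => /(_ Nqp);
    rewrite norm_ncE lecR => /le_trans; apply.
  apply: le_trans (_ : 1 * (1 + C) ^+ (plength q + plength p) <= _).
    by rewrite mul1r lerXn2r ?nnegrE ?addr_ge0 ?lerDr ?(ltW C0).
  by rewrite ler_wpM2r ?lerDl // (le_trans ler01).
have [_ GB] := HB a; apply: le_trans (GB p q _ _) _.
- exact: leq_ltn_trans (leq_addl _ _) qpN.
- exact: leq_ltn_trans (leq_addr _ _) qpN.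
apply: le_trans (_ : (1 + \sum_a B a) * 1 <= _).
  rewrite mulr1 (bigD1 a) //= addrCA lerDl addr_ge0 // sumr_ge0 // => b _.
  by case: (HB b).
by rewrite ler_wpM2l // addr_ge0.
Qed.

End JacobiSeries.

(** * A bounded right inverse from Jacobi expansions *)

Section JacobiIdeal.
Variables (R : realType) (Q : quiver) (F : series R Q).
Notation S := (series R Q).
Notation nc := (@normc R).
Notation D a := (cyclic_derivative a F).
Implicit Types (f h X : S) (x y z : vertex Q) (a b : arrow Q) (rho : R).
Implicit Types (u w v s t : seq (arrow Q)) (n k d : nat) (g : arrow Q -> S).

Lemma analyticM f h : is_analytic f -> is_analytic h -> is_analytic (f * h).
Proof.
move=> fa ha; have [_ _ H] := analytic_subring_closed R Q.
by apply/asboolP/H; apply/asboolP.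
Qed.

Lemma analyticB f h : is_analytic f -> is_analytic h -> is_analytic (f - h).
Proof.
move=> fa ha; have [_ H _] := analytic_subring_closed R Q.
by apply/asboolP/H; apply/asboolP.
Qed.

Lemma analytic1 : is_analytic (1 : S).
Proof. by have [H _ _] := analytic_subring_closed R Q; apply/asboolP. Qed.

Lemma analytic0 : is_analytic (0 : S).
Proof. by rewrite -(subrr 1); apply: analyticB analytic1 analytic1. Qed.

Lemma analyticD f h : is_analytic f -> is_analytic h -> is_analytic (f + h).
Proof.
move=> fa ha; rewrite -[h]opprK -[- h]sub0r.
exact: analyticB fa (analyticB analytic0 ha).
Qed.

Lemma analyticZ c f : is_analytic f -> is_analytic (c *: f).
Proof. by move=> fa; apply/asboolP/analytic_scale_closed/asboolP. Qed.

Lemma analytic_ar a : is_analytic (ar R a).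
Proof. exact/asboolP/monomial_analytic. Qed.

Lemma small_radius (C r : R) : 0 <= C -> 0 < r -> exists rho, [/\ 0 < rho,
  rho <= r & forall rho', 0 <= rho' -> rho' <= rho ->
    rho' * C * #|arrow Q|%:R <= 2^-1].
Proof.
move=> C0 r0; pose A : R := #|arrow Q|%:R; have A0 : 0 <= A by [].
have d0 : 0 <= 2 * C * A * r by rewrite !mulr_ge0 // ltW.
have d1 : 0 < 1 + 2 * C * A * r by rewrite ltr_wpDr.
exists (r / (1 + 2 * C * A * r)); split=> [||rho' r'0 r'r].
- exact: divr_gt0.
- by rewrite ler_pdivrMr // ler_peMr ?lerDl // ltW.
apply: (@le_trans _ _ (r / (1 + 2 * C * A * r) * C * A)).
  by rewrite -(mulrA rho') -(mulrA (r / _)) ler_wpM2r // mulr_ge0.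
have -> : r / (1 + 2 * C * A * r) * C * A =
    2^-1 * ((2 * C * A * r) / (1 + 2 * C * A * r)).
  by field; rewrite gt_eqF.
by rewrite ler_piMr ?invr_ge0 // ler_pdivrMr // mul1r lerDr.
Qed.

Lemma is_jacD f h : is_jac F f -> is_jac F h -> is_jac F (f + h).
Proof.
move=> [A [[M [C [M0 C0 AM]]] Af]] [B [[N [E [N0 E0 BN]]] Bh]].
exists (fun a y v => A a y v + B a y v); split.
  exists (M + N), (C + E); split; rewrite ?addr_ge0 // => a y v z u.
  rewrite coefD; apply: le_trans (le_normcD _ _) _; rewrite mulrDl lerD //.
    apply: le_trans (AM a y v z u) _.
    by rewrite ler_wpM2l // lerXn2r ?nnegrE ?addr_ge0 ?lerDl.
  apply: le_trans (BN a y v z u) _.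
  by rewrite ler_wpM2l // lerXn2r ?nnegrE ?addr_ge0 ?lerDr.
move=> n; under eq_bigr do rewrite jsumD.
by rewrite big_split opprD addrACA; apply: orderD.
Qed.

Lemma is_jacMl f h : is_analytic h -> is_jac F f -> is_jac F (h * f).
Proof.
move=> /analytic_wbounded[r [B [r0 B0 hB]]] [A [[M [C [M0 C0 AM]]] Af]].
have [rho [rho0 rhor rhoC]] := small_radius C0 r0.
exists (fun a y v => h * A a y v); split; last first.
  move=> n; under eq_bigr do rewrite -jsumMl.
  by rewrite -mulr_sumr -mulrBr; apply: orderMl.
have rho0' := ltW rho0; have V0 : 0 <= #|vertex Q|%:R :> R by [].
(* The product is estimated in norm at radius rho; returning to coefficients costs a factor [rho^-1]
   per arrow. *)
have Ci : 0 <= C + rho^-1 by rewrite addr_ge0 // invr_ge0.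
exists (B * (2 * #|vertex Q|%:R * M)), (C + rho^-1); split=> //.
  by rewrite !mulr_ge0.
move=> a y v z u; have := wnorm_coef (h * A a y v) z u rho0'.
rewrite -ler_pdivlMr ?exprn_gt0 // => /le_trans; apply.
rewrite exprD mulrA ler_pM ?invr_ge0 ?exprn_ge0 ?wnorm_ge0 //; last first.
  by rewrite -exprVn lerXn2r ?nnegrE ?invr_ge0 ?lerDr.
apply: le_trans (wnormM _ _ _ rho0') _.
have Ab : wbounded rho (A a y v) (2 * #|vertex Q|%:R * (M * C ^+ size v)).
  apply: (@coef_wbounded _ _ _ _ C) => //; rewrite ?mulr_ge0 ?exprn_ge0 //.
    exact: rhoC.
  by move=> z' u'; rewrite -mulrA -exprD.
apply: le_trans (ler_pM _ _ (wbounded_le rho0' rhor (lexx _) hB _) (Ab _)) _;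
  rewrite ?wnorm_ge0 //.
rewrite -!mulrA !ler_wpM2l // lerXn2r ?nnegrE ?lerDl ?invr_ge0 //.
Qed.

Lemma is_jac0 : is_jac F 0.
Proof.
exists (fun a y v => 0); split.
  by exists 0, 0; split=> // a y v z u; rewrite coef0 normc0 mul0r.
move=> n; rewrite big1 ?subrr // => a _; elim: n (D a) => //= n IH X.
rewrite big1 => [|x _]; last by rewrite !mul0r.
by rewrite add0r big1 // => b _; apply: IH.
Qed.

Lemma is_jacZ c f : is_jac F f -> is_jac F (c *: f).
Proof.
move=> fJ; rewrite -[f]mul1r -scaleMl; apply: is_jacMl => //.
exact/analyticZ/analytic1.
Qed.

Lemma is_jac_sum (I : Type) (r : seq I) (P : pred I) (f : I -> S) :
  (forall i, P i -> is_jac F (f i)) -> is_jac F (\sum_(i <- r | P i) f i).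
Proof.
by move=> fJ; elim/big_ind: _ => //; [exact: is_jac0|exact: is_jacD].
Qed.

Definition word s : S := foldr (fun a f => ar R a * f) 1 s.

Lemma word_cons a s : word (a :: s) = ar R a * word s. Proof. by []. Qed.

Lemma word_rcons s a : word (rcons s a) = word s * ar R a.
Proof.
elim: s => [|b s IH] /=; first by rewrite mulr1 mul1r.
by rewrite IH mulrA.
Qed.

Lemma word_order s : order (size s) (word s).
Proof. by elim: s => //= a s IH; rewrite -add1n; apply: orderM. Qed.

Lemma word_analytic s : is_analytic (word s).
Proof.
elim: s => [|a s IH]; first exact: analytic1.
exact/analyticM/IH/analytic_ar.
Qed.

Lemma finite_lower_bound (I : finType) (r : I -> R) : (forall i, 0 < r i) ->
  exists2 rho, 0 < rho & forall i, rho <= r i.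
Proof.
move=> r0; have s0 : 0 <= \sum_i (r i)^-1.
  by apply: sumr_ge0 => i _; rewrite invr_ge0 ltW.
have s1 : 0 < 1 + \sum_i (r i)^-1 by rewrite ltr_wpDr.
exists (1 + \sum_i (r i)^-1)^-1; first by rewrite invr_gt0.
move=> i; rewrite -[leRHS]invrK lef_pV2 ?posrE ?invr_gt0 //.
rewrite (bigD1 i) //= addrCA lerDl addr_ge0 // sumr_ge0 // => j _.
by rewrite invr_ge0 ltW.
Qed.

(* A bounded right inverse of [g |-> \sum_a g a * D a] on series of order k,
   up to commutators and multiplication by [X]. *)
Definition solution k X (L : S -> arrow Q -> S) (c r : R) := [/\ 0 <= c, 0 < r,
  forall f h a, L (f - h) a = L f a - L h a,
  forall n f a, order n f -> order (n - k) (L f a) &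
  (forall f, order k f -> forall n, comm n (\sum_a L f a * D a - f * X)) /\
  (forall rho n f a, 0 < rho -> rho <= r ->
     rho ^+ k * wnorm rho n (L f a) <= c * wnorm rho (n + k) f)].

(** With A the Jacobi coefficients of X, [bil_jsum] turns the sum of [bil (A a) f * D a] into f
    times the expansion of X. *)
Lemma is_jac_solution X : is_jac F X -> exists L c r, solution 0 X L c r.
Proof.
move=> [A [[M [C [M0 C0 AM]]] AX]].
have [r [r0 _ rC]] := small_radius C0 ltr01.
have V0 : 0 <= #|vertex Q|%:R :> R by [].
(* One factor [2 * #|vertex Q|] bounds each series [A a x v], the other comes from the sum over v in
   [bil]. *)
exists (fun f a => bil (A a) f),
  (2 * #|vertex Q|%:R * (2 * #|vertex Q|%:R * M)), r.
split=> //; [by rewrite !mulr_ge0|by move=> *; apply: bilB| |].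
  by move=> n f a fn; rewrite subn0; apply: bil_order.
split=> [f _ n|rho n f a rho0 rhor].
  apply: (@comm_trans _ _ _ _ (f * \sum_a jsum n (A a) (D a))).
    rewrite mulr_sumr -sumrB; apply: comm_sum => a _.
    by apply: (@bil_jsum _ _ 0).
  by rewrite -mulrBr; apply/comm_order/orderMl/order_sym.
rewrite expr0 mul1r addn0; apply: (@wnorm_bil _ _ _ _ _ C);
  rewrite ?(ltW rho0) //.
- by rewrite !mulr_ge0.
- by apply: rC => //; apply: ltW.
move=> x v; rewrite -[_ * M * _]mulrA; apply: (@coef_wbounded _ _ _ _ C) => //;
  rewrite ?(ltW rho0) //.
- by rewrite mulr_ge0 ?exprn_ge0.
- by apply: rC => //; apply: ltW.
by move=> y u; rewrite -mulrA -exprD.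
Qed.

(** The first arrow b of f is stripped off and rotated behind X. The loss of one order and of one
    factor rho is that of [der b]. *)
Lemma solution_step k X : (forall b, exists L c r,
  solution k (X * ar R b) L c r) ->
  exists L c r, solution k.+1 X L c r.
Proof.
move=> H; have H' b : exists T : (S -> arrow Q -> S) * (R * R),
    solution k (X * ar R b) T.1 T.2.1 T.2.2.
  by have [L [c [r LP]]] := H b; exists (L, (c, r)).
have {H H'}[T TP] := choice H'.
have [r r0 rT] : exists2 r, 0 < r & forall b, r <= (T b).2.2.
  by apply: finite_lower_bound => b; case: (TP b).
exists (fun f a => \sum_b (T b).1 (der b f) a), (\sum_b (T b).2.1), r;
  split=> //.
- by apply: sumr_ge0 => b _; case: (TP b).
- move=> f h a; rewrite -sumrB; apply: eq_bigr => b _; rewrite derB.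
  by case: (TP b) => _ _ -> _ _.
- move=> n f a fn; apply: order_sum => b _;
  have -> : (n - k.+1 = n.-1 - k)%N by lia.
  case: (TP b) => _ _ _ + _; apply; exact: order_der.
split=> [f fk n|rho n f a rho0 rhor].
  under eq_bigr do rewrite mulr_suml.
  rewrite exchange_big /= {2}(order_rder fk) mulr_suml -sumrB.
  apply: comm_sum => b _; case: (TP b) => _ _ _ _ [+ _].
  have fk' : order k (der b f) by exact: order_der fk.
  move=> /(_ _ fk' n) Tb; apply: comm_trans Tb _.
  apply: comm_sym; rewrite -[ar R b * der b f * X]mulrA [der b f * (X *
    _)]mulrA.
  exact: comm_bracket.
have rho0' := ltW rho0.
apply: (@le_trans _ _ (rho ^+ k.+1 * \sum_b wnorm rho n ((T b).1 (der b f) a))).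
  by rewrite ler_wpM2l ?exprn_ge0 // wnorm_sum.
rewrite mulr_sumr mulr_suml; apply: ler_sum => b _.
case: (TP b) => c0 _ _ _ [_ /(_ rho n (der b f) a rho0 (le_trans rhor (rT b)))
  Tb].
rewrite exprS -mulrA; apply: le_trans (ler_wpM2l rho0' Tb) _.
by rewrite mulrCA ler_wpM2l // addnS wnorm_der.
Qed.

(** Starts from k = 0 at the words of length r, whose expansions are given, and shortens the word
    down to X = 1 at k = r. *)
Lemma jacobi_solution r : (forall s, size s = r -> is_jac F (word s)) ->
  exists L c rho, solution r 1 L c rho.
Proof.
move=> Jr; suff: forall k s, (size s + k = r)%N ->
    exists L c rho, solution k (word s) L c rho by move=> /(_ r [::]); apply.
elim=> [|k IH] s sk; first by apply/is_jac_solution/Jr; rewrite -sk addn0.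
apply: solution_step => b; rewrite -word_rcons; apply: IH.
by rewrite size_rcons addSnnS.
Qed.

End JacobiIdeal.

(** * Nakayama's lemma for words of fixed length *)

Section Nakayama.
Variables (R : realType) (Q : quiver) (F : series R Q).
Notation S := (series R Q).
Implicit Types (f h X : S) (x y z : vertex Q) (a b : arrow Q) (rho : R).
Implicit Types (u w v t : seq (arrow Q)) (n k d : nat) (s : seq S).

Definition rder b f : S := fun p => coef f (pstart p) (rcons (parrows p) b).

Lemma is_path_rcons x w b :
  is_path x (rcons w b) = is_path x w && (endpoint x w == src b).
Proof. by rewrite -cats1 is_path_cat /= andbT eq_sym. Qed.

Lemma coef_rder b f x w : coef (rder b f) x w = coef f x (rcons w b).
Proof.
case: (boolP (is_path x w)) => xw; first by rewrite (coef_path _ xw).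
by rewrite !coef_out // is_path_rcons (negPf xw).
Qed.

Lemma order_rderE f : order 1 f -> f = \sum_b rder b f * ar R b.
Proof.
move=> f1; apply: series_ext => x w; rewrite coef_sum.
case/lastP: w => [|w c].
  by rewrite f1 // big1 // => b _; rewrite coef_Mar0.
rewrite (bigD1 c) //= coef_Mar eqxx andbT coef_rder big1 ?addr0 => [|b bc].
  by case: eqP => // /eqP xc;
    rewrite coef_out // is_path_rcons (negPf xc) andbF.
by rewrite coef_Mar [c == b]eq_sym (negPf bc) andbF.
Qed.

Lemma rder_order n b f : order n.+1 f -> order n (rder b f).
Proof. by move=> fn x w wn; rewrite coef_rder fn // size_rcons. Qed.

Lemma rder_analytic b f : is_analytic f -> is_analytic (rder b f).
Proof.
move=> /analyticP[[M C] /= [M1 C1] fb].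
have M0 : 0 <= M := le_trans ler01 M1; have C0 : 0 <= C := le_trans ler01 C1.
apply: (@analytic_bound _ _ _ (M * C) C); rewrite ?mulr_ge0 // => p.
have := coef_bound (pstart p) (rcons (parrows p) b) M0 C0 fb.
by rewrite size_rcons exprS mulrA.
Qed.

Lemma one_sub_inverse h : is_analytic h -> order 1 h ->
  exists2 u, is_analytic u & u * (1 - h) = 1.
Proof.
move=> ha h1; pose u k := iter k (fun f => 1 + f * h) (0 : S).
have uS k : order k (u k.+1 - u k).
  elim: k => // k IH; rewrite /= opprD addrACA subrr add0r -mulrBl -addn1.
  exact: orderM.
have lu k : order k (alim u - u k) by apply: alim_mod.
have [r [B [r0 B0 hB]]] := analytic_wbounded ha.
(* At this radius h has norm at most 1/2, and 1 has norm at most [#|vertex Q|], so the bound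
   [2 * #|vertex Q|] is preserved by the iteration f -> 1 + f h. *)
pose rho := r / (1 + 2 * B);
  have d0 : 0 < 1 + 2 * B by rewrite ltr_wpDr ?mulr_ge0.
have rho0 : 0 < rho by apply: divr_gt0.
have rhor : rho <= r by rewrite ler_pdivrMr // ler_peMr ?lerDl ?mulr_ge0 // ltW.
have rho0' := ltW rho0.
have hb : wbounded rho h 2^-1.
  move=> n; apply: le_trans (wbounded_scale rho0' r0 rhor h1 hB n) _.
  have -> : (rho / r) ^+ 1 * B = 2^-1 * ((2 * B) / (1 + 2 * B)).
    by rewrite /rho; field; rewrite !gt_eqF.
  by rewrite ler_piMr ?invr_ge0 // ler_pdivrMr // mul1r lerDr.
have V0 : 0 <= #|vertex Q|%:R :> R by [].
have ub k : wbounded rho (u k) (2 * #|vertex Q|%:R).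
  elim: k => [|k IH] n; first by rewrite wnorm0 mulr_ge0.
  apply: le_trans (wnormD _ _ _ rho0') _.
  have -> : 2 * #|vertex Q|%:R = #|vertex Q|%:R + 2 * #|vertex Q|%:R * 2^-1 :>
    R by field.
  rewrite lerD ?wnorm1 //; apply: le_trans (wnormM _ _ _ rho0') _.
  by rewrite ler_pM ?wnorm_ge0.
exists (alim u); first exact: wbounded_analytic rho0 (wbounded_limit rho0' lu
  ub).
apply: order_eq => n; rewrite mulrBr mulr1.
apply: (@orderW _ _ n.+1) => //; rewrite -addrA -opprD.
apply: (order_trans (g := u n.+1)); first exact: lu.
have -> : u n.+1 - (alim u * h + 1) = - ((alim u - u n) * h).
  by rewrite mulrBl opprB [alim u * h + 1]addrC opprD addrACA subrr add0r.
rewrite -addn1; apply/orderN/orderM => //; exact: lu.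
Qed.

(* Left combinations of [s] with coefficients in the maximal ideal, modulo the
   Jacobi ideal. *)
Fixpoint lspan s f : Prop := if s is w :: s' then
    exists h, [/\ is_analytic h, order 1 h & lspan s' (f - h * w)]
  else is_jac F f.

Lemma lspan_jac s f : is_jac F f -> lspan s f.
Proof.
elim: s => //= w s IH fJ; exists 0; split=> //.
  exact: analytic0.
by rewrite mul0r subr0; apply: IH.
Qed.

Lemma lspanD s f h : lspan s f -> lspan s h -> lspan s (f + h).
Proof.
elim: s f h => [|w s IH] f h /=; first exact: is_jacD.
move=> [k [ka k1 fk]] [l [la l1 hl]]; exists (k + l); split.
- exact: analyticD.
- exact: orderD.
by rewrite mulrDl opprD addrACA; apply: IH.
Qed.

Lemma lspanMl s f h : is_analytic h -> lspan s f -> lspan s (h * f).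
Proof.
move=> ha; elim: s f => [|w s IH] f /=; first exact: is_jacMl.
move=> [k [ka k1 fk]]; exists (h * k); split;
  [exact: analyticM|exact: orderMl|].
by rewrite -mulrA -mulrBr; apply: IH.
Qed.

Lemma lspan_sum s (I : Type) (r : seq I) (P : pred I) (G : I -> S) :
  (forall i, P i -> lspan s (G i)) -> lspan s (\sum_(i <- r | P i) G i).
Proof.
move=> Gs; elim/big_ind: _ => //; last exact: lspanD.
exact/lspan_jac/is_jac0.
Qed.

Lemma lspan_gen s h (w : S) : w \in s -> is_analytic h -> order 1 h ->
  lspan s (h * w).
Proof.
elim: s => // w' s IH; rewrite inE => /predU1P[->|ws] ha h1 /=.
  exists h; split=> //; rewrite subrr; exact/lspan_jac/is_jac0.
exists 0; split=> //; last by rewrite mul0r subr0; apply: IH.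
exact: analytic0.
Qed.

Lemma lspan_sub s f : (forall w : S, w \in s -> is_jac F w) ->
  lspan s f -> is_jac F f.
Proof.
elim: s f => //= w s IH f sJ [k [ka k1 fk]].
rewrite -(subrK (k * w) f); apply: is_jacD; last first.
  by apply: is_jacMl => //; apply: sJ; rewrite mem_head.
by apply: IH fk => v vs; apply: sJ; rewrite inE vs orbT.
Qed.

(** Induction on the number of generators: as 1 - h is invertible, the first generator is eliminated
    from its own relation and then from all the others. *)
Lemma nakayama s : (forall w : S, w \in s -> is_analytic w) ->
  (forall w : S, w \in s -> lspan s w) -> forall w : S, w \in s -> is_jac F w.
Proof.
elim: s => // w s IH sa ss.
have [h [ha h1 hw]] := ss w (mem_head _ _).
have ws : lspan s w.
  have [u ua uh] := one_sub_inverse ha h1.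
  rewrite -[w]mul1r -uh -mulrA; apply: lspanMl => //.
  by rewrite mulrBl mul1r.
have sJ (v : S) : v \in s -> is_jac F v.
  apply: IH => {}v vs; first by apply: sa; rewrite inE vs orbT.
  have [|k [ka k1 kv]] := ss v; first by rewrite inE vs orbT.
  by rewrite -(subrK (k * w) v); apply: lspanD => //; apply: lspanMl.
have wJ := lspan_sub sJ ws.
by move=> v; rewrite inE => /predU1P[->|/sJ].
Qed.

Definition words k : seq S := [seq word R (tval p) | p <- enum {: k.-tuple
  (arrow Q)}].

Lemma mem_words t : word R t \in words (size t).
Proof. by apply/mapP; exists (in_tuple t); rewrite ?mem_enum. Qed.

(** Last arrows of f are moved onto the word until the coefficient in front has order just 1, as
    [lspan] demands. *)
Lemma lspan_words k f t : is_analytic f -> order k.+1 f ->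
  lspan (words (k + size t)) (f * word R t).
Proof.
elim: k f t => [|k IH] f t fa fk; first exact: lspan_gen (mem_words t) fa fk.
rewrite (order_rderE (orderW _ fk)) // mulr_suml; apply: lspan_sum => b _.
rewrite -mulrA -word_cons addSnnS; apply: IH; first exact: rder_analytic.
exact: rder_order.
Qed.

Lemma jacobi_words k :
  (forall f, is_analytic f -> order k f ->
     exists j, [/\ is_analytic j, is_jac F j & order k.+1 (f - j)]) ->
  forall t, size t = k -> is_jac F (word R t).
Proof.
move=> Jk t tk; apply: (@nakayama (words k)) => [_ /mapP[u _ ->]|_ /mapP[u _
  ->]|].
- exact: word_analytic.
- have uk : order k (word R u) by rewrite -{1}(size_tuple u); exact: word_order.
  have [j [ja jJ kj]] := Jk (word R u) (word_analytic _ _) uk.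
  rewrite -(subrK j (word R u)); apply: lspanD; last exact: lspan_jac.
  rewrite -[_ - _]mulr1; have := @lspan_words k (word R u - j) [::].
  by rewrite addn0; apply=> //; apply: analyticB => //; apply: word_analytic.
by rewrite -tk; apply: mem_words.
Qed.

End Nakayama.

(** * From finite dimension to words in the ideal *)

Section JacobiFinite.
Variables (R : realType) (Q : quiver) (Phi : potential R Q).

Lemma analytic_valZ c (f : analytic R Q) :
  analytic_val (c *: f) = c *: analytic_val f.
Proof. exact: (linearZ_LR val). Qed.

Lemma analytic_val_sum (I : Type) (r : seq I) (P : pred I) (f : I ->
  analytic R Q) :
  analytic_val (\sum_(i <- r | P i) f i) = \sum_(i <- r | P i) analytic_val (f
    i).
Proof. exact: (raddf_sum val). Qed.

Lemma analytic_valP (f : analytic R Q) : is_analytic (analytic_val f).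
Proof. exact/asboolP/(valP f). Qed.

Lemma dependent_rows (K : fieldType) n (c : 'M[K]_(n.+1, n)) :
  exists2 v : 'rV[K]_n.+1, v != 0 & v *m c = 0.
Proof.
have : kermx c != 0.
  by rewrite kermx_eq0 /row_free neq_ltn (leq_ltn_trans (rank_leq_col c)).
case/rowV0Pn => v /sub_kermxP vc v0; by exists v.
Qed.

(** Otherwise each k has some f_k of order k that is not in the ideal modulo order k+1. Among n+1 of
    these there is a linear relation modulo the ideal, and its term of lowest index gives a
    contradiction. *)
Lemma jacobi_finite_words : jacobi_finite Phi ->
  exists k, forall t, size t = k -> is_jac (representative Phi) (word R t).
Proof.
set F := analytic_val (representative Phi).
move=> [n [b Jb]]; apply: contrapT => noJ.
have bad k : exists f : analytic R Q, order k (analytic_val f) /\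
    forall j, is_analytic j -> is_jac F j -> ~ order k.+1 (analytic_val f - j).
  apply: contrapT => nok; apply: noJ; exists k; apply: jacobi_words => f fa fk.
  apply: contrapT => nof; apply: nok.
  have fa' : f \in @analytic_pred R Q by apply/asboolP.
  exists (Analytic fa'); split=> // j ja jJ fj; apply: nof; by exists j.
have [f fP] := choice bad.
have [c cP] := choice (fun k => Jb (f k)).
have [v v0 vc] := dependent_rows (\matrix_(i < n.+1, l < n) c i l).
have [i0 vi0] : exists i, v 0 i != 0.
  by case/rV0Pn: v0 => i vi; exists i.
(* The other terms of the relation have larger index, hence order at least m+1; dividing by [v 0 m]
   puts f_m in the ideal modulo that order. *)
pose m := [arg min_(i < i0 | v 0 i != 0) (i : nat)].
have [vm mmin] : v 0 m != 0 /\ forall i, v 0 i != 0 -> (m <= i)%N.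
  by rewrite /m; case: arg_minnP.
pose J k := analytic_val (f k - \sum_(i < n) c k i *: b i).
have JJ k : is_jac F (J k) by apply: jacobi_ideal_is_jac.
have fE : \sum_(i < n.+1) v 0 i *: analytic_val (f i) = \sum_(i < n.+1) v 0 i
  *: J i.
  have -> : \sum_(i < n.+1) v 0 i *: J i =
    \sum_(i < n.+1) v 0 i *: analytic_val (f i) -
    \sum_(l < n) (\sum_(i < n.+1) v 0 i * c i l) *: analytic_val (b l).
    rewrite (eq_bigr (fun i : 'I_n.+1 => v 0 i *: analytic_val (f i) -
      \sum_(l < n) (v 0 i * c i l) *: analytic_val (b l))) => [|i _].
      rewrite sumrB exchange_big; congr (_ - _); apply: eq_bigr => l _.
      by rewrite scaler_suml.
    rewrite /J analytic_valB scalerBr analytic_val_sum scaler_sumr;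
      congr (_ - _).
    by apply: eq_bigr => l _; rewrite analytic_valZ scalerA.
  rewrite [X in _ - X]big1 ?subr0 // => l _.
  have /matrixP/(_ 0 l) := vc; rewrite !mxE => E.
  rewrite [X in X *: _](_ : _ = 0) ?scale0r // -[RHS]E.
  by apply: eq_bigr => i _; rewrite mxE.
pose j := (v 0 m)^-1 *: \sum_(i < n.+1) v 0 i *: J i.
have [_ /(_ j)] := fP m; apply.
- apply: analyticZ; under eq_bigr do rewrite -analytic_valZ.
  rewrite -analytic_val_sum; exact: analytic_valP.
- by apply: is_jacZ; apply: is_jac_sum => i _; apply: is_jacZ.
rewrite /j -fE (bigD1 m) //= scalerDr scalerA mulVf // scale1r opprD addrA
  subrr.
rewrite add0r; apply/orderN/orderZ/order_sum => i im.
have [->|vi] := eqVneq (v 0 i) 0; first by rewrite scale0r.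
apply: orderZ; have [fi _] := fP i; apply: orderW fi.
by rewrite ltn_neqAle mmin // andbT eq_sym.
Qed.

End JacobiFinite.

(** * Automorphisms and determinacy *)

Section Automorphisms.
Variables (R : realType) (Q : quiver).
Notation S := (series R Q).
Implicit Types (f h : S) (x : vertex Q) (a b : arrow Q) (rho : R).
Implicit Types (n k d : nat) (g : arrow Q -> S) (chi psi : S -> S).

Definition analytic_endo chi :=
  endo chi /\ forall f, is_analytic f -> is_analytic (chi f).

Definition analytic_auto chi := exists psi, [/\ analytic_endo chi,
  analytic_endo psi, cancel chi psi & cancel psi chi].

Lemma analytic_endo_comp chi psi :
  analytic_endo chi -> analytic_endo psi -> analytic_endo (chi \o psi).
Proof.
move=> [e a] [e' a']; split; first exact: endo_comp.
by move=> f fa; apply/a/a'.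
Qed.

Lemma analytic_auto_comp chi psi :
  analytic_auto chi -> analytic_auto psi -> analytic_auto (chi \o psi).
Proof.
move=> [chi' [e e' K K']] [psi' [f f' L L']]; exists (psi' \o chi').
by split; [exact: analytic_endo_comp|exact: analytic_endo_comp|
  exact: can_comp|exact: can_comp].
Qed.

Lemma analytic_auto_id : analytic_auto id.
Proof. by exists id; split=> //; split=> //; split. Qed.

(** Order 2 makes the norm quadratic in the radius, hence below rho for small rho. The radius 2 rho
    is the one required by [wnorm_subst2]. *)
Lemma small_images g : (forall a, is_analytic (g a)) ->
  (forall a, order 2 (g a)) ->
  exists2 r, 0 < r & forall rho, 0 < rho -> rho <= r ->
    forall a, wbounded (2 * rho) (g a) rho.
Proof.
move=> ga g2; have H a : exists T : R * R,
    [/\ 0 < T.1, 0 <= T.2 & wbounded T.1 (g a) T.2].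
  by have [r [B rB]] := analytic_wbounded (ga a); exists (r, B).
have {H}[T TP] := choice H.
have [r r0 rT] : exists2 r, 0 < r & forall a, r <= (T a).1.
  by apply: finite_lower_bound => a; case: (TP a).
pose B := \sum_a (T a).2; have B0 : 0 <= B.
  by apply: sumr_ge0 => a _; case: (TP a).
have d0 : 0 < 2 * r + 4 * B by rewrite ltr_wpDr ?mulr_ge0 // mulr_gt0.
(* The term 2r ensures 2 rho <= r, and 4B ensures (2 rho / r)^2 B <= rho. *)
exists (r ^+ 2 / (2 * r + 4 * B)); first by rewrite divr_gt0 ?exprn_gt0.
move=> rho rho0; rewrite ler_pdivlMr // => rhor a.
have rho0' := ltW rho0.
have rho2 : 0 <= 2 * rho by rewrite mulr_ge0.
have rB0 : 0 <= rho * B by rewrite mulr_ge0.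
have rho2r : 2 * rho <= r by rewrite -(ler_pM2r r0); nra.
have gB : wbounded r (g a) B.
  case: (TP a) => _ _; apply: wbounded_le; rewrite ?(ltW r0) //.
  rewrite /B (bigD1 a) //= lerDl sumr_ge0 // => b _; by case: (TP b).
move=> n; apply: le_trans (wbounded_scale rho2 r0 rho2r (g2 a) gB n) _.
rewrite expr_div_n mulrAC ler_pdivrMr ?exprn_gt0 //; nra.
Qed.

Lemma subst_analytic g f : (forall a, is_analytic (g a)) ->
  (forall a, order 2 (g a)) -> is_analytic f -> is_analytic (subst g f).
Proof.
move=> ga g2 /analytic_wbounded[rf [B [rf0 B0 fB]]].
have [r r0 rP] := small_images ga g2.
pose rho := Num.min r (rf / 2).
have rho0 : 0 < rho by rewrite lt_min r0 divr_gt0.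
have rho0' := ltW rho0.
apply: (@wbounded_analytic _ _ _ rho B) => // n.
have g1 a : order 1 (g a) by apply: orderW (g2 a).
apply: le_trans (wnorm_subst2 (eps := rho) rho0 _ g1 _ _ n f) _ => //.
  move=> a; apply: (@wbounded_le _ _ _ (2 * rho) _ rho) => //.
    by rewrite ler_peMl // ler1n.
  by apply: rP => //; rewrite ge_min lexx.
apply: le_trans (wnorm_le _ _ _ _) (fB n); rewrite ?mulr_ge0 //.
by rewrite mulrC -ler_pdivlMr // ge_min lexx orbT.
Qed.

(** The condition of [subst_left_inverse] is a fixed point equation. Its map contracts adically
    since g has order 2, and [small_images] keeps the iterates in a ball of radius r. *)
Lemma subst_inverse g : (forall a, is_analytic (g a)) ->
  (forall a, order 2 (g a)) -> exists g', [/\ forall a, is_analytic (g' a),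
    forall a, order 2 (g' a) & cancel (subst g) (subst g')].
Proof.
move=> ga g2; pose T (h : arrow Q -> S) a := - subst h (g a).
have o1 (h : arrow Q -> S) : (forall a, order 2 (h a)) ->
  forall a, order 1 (h a).
  by move=> h2 a; apply: orderW (h2 a).
have [|h h' d h2 h2' hh' a|g' [g2' g'E g'l]] := @adic_fixpoint R Q T 2.
- by move=> h h2 a; apply/orderN/subst_order => //; apply: o1.
- rewrite /T opprK addrC; have := subst_contract (s := 2) isT h2' h2 _ (g2 a).
  by apply=> b; apply: order_sym.
exists g'; split=> //; last by apply: subst_left_inverse => //; apply: o1.
have [r r0 rP] := small_images ga g2.
move=> a; apply: (@wbounded_analytic _ _ _ r r) => //.
apply: (wbounded_limit (ltW r0) (fun k => g'l k a)) => k.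
have ks : forall j b, order 2 (iter j T (fun=> 0) b).
  elim=> [|j IH] b; first exact: order_zero.
  by apply/orderN/subst_order => //; apply: o1.
elim: k a => [|k IH] a n; first by rewrite wnorm0 ltW.
rewrite [iter _ _ _]/= /T wnormN.
apply: le_trans (wnorm_subst2 (eps := r) r0 (ltW r0) (o1 _ (ks k)) IH _ n _) _
  => //.
exact: rP.
Qed.

Lemma subst_auto g : (forall a, is_analytic (g a)) ->
  (forall a, order 2 (g a)) -> analytic_auto (subst g).
Proof.
have sub_endo (h : arrow Q -> S) : (forall a, is_analytic (h a)) ->
  (forall a, order 2 (h a)) ->
    analytic_endo (subst h).
  move=> ha h2; split; last by move=> f; apply: subst_analytic.
  by apply: endo_subst => a; apply: orderW (h2 a).
move=> ga g2; have [g' [ga' g2' K]] := subst_inverse ga g2.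
(* A left inverse of the left inverse must agree with [subst g], so [subst g'] is a two-sided
   inverse. *)
have [g'' [ga'' g2'' K']] := subst_inverse ga' g2'.
exists (subst g'); split=> //; [exact: sub_endo|exact: sub_endo|].
have E f : subst g f = subst g'' f by rewrite -{2}(K f) K'.
by move=> f; rewrite E K'.
Qed.

Lemma trunc_analytic n f : is_analytic (trunc n f).
Proof.
exists 1; split=> //; exists n => p np; rewrite /trunc ltnNge np /= normr0.
by rewrite expr1n (lecR 0).
Qed.

End Automorphisms.

(** * Reaching a prescribed potential *)

Section Determinacy.
Variables (R : realType) (Q : quiver) (F : series R Q) (r : nat).
Notation S := (series R Q).
Notation D a := (cyclic_derivative a F).
Variables (L : S -> arrow Q -> S) (c0 r0 : R).
Hypothesis LP : solution F r 1 L c0 r0.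
Implicit Types (f h : S) (x : vertex Q) (a b : arrow Q) (rho : R).
Implicit Types (n k d N : nat) (g : arrow Q -> S) (chi psi : S -> S).

Let xi_L f n : order r f -> comm n (xi (L f) F - f).
Proof.
case: LP => _ _ _ _ [Lc _] fr; apply: comm_trans.
  exact: xi_cyclic_derivative.
by rewrite -[X in _ - X]mulr1; apply: Lc.
Qed.

(* If [xi F] is [T] up to commutators, with [T] of order N, then the terms of
   degree at least 2 of [exp xi F] are values of [xi] at [T], up to scalars and
   commutators, hence of order > N. *)
Lemma jet_step N chi G : (r.+2 <= N)%N -> analytic_auto chi ->
  comm N (chi F - G) ->
  exists2 chi', analytic_auto chi' & comm N.+1 (chi' F - G).
Proof.
move=> rN chiA; case: (chiA) => psi [[e _] [e' _] K K'] chiG.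
(* The difference is pulled back by the inverse of chi, because L inverts the derivative at F and
   not at [chi F]. *)
have : comm N (psi (G - chi F)) by apply: endo_comm => //; apply: comm_sym.
rewrite (endoB _ _ e') K => -[c cc]; set T := _ - _ - c.
have GE : psi G = F + T + c by rewrite /T -addrA subrK addrC subrK.
move: T GE => T GE TN.
have g2 a : order 2 (L T a).
  by case: LP => _ _ _ Lo _; apply: orderW (Lo _ _ a TN);
    rewrite ltn_subRL addn1.
pose h := exp_arrow (L T) N.+1.
exists (chi \o subst h).
  apply: analytic_auto_comp => //; apply: subst_auto => a.
    exact: trunc_analytic.
  exact: exp_arrow_order.
have xiT n : comm n (xi (L T) F - T).
  by apply: xi_L; apply: orderW TN; rewrite ltnW // ltnW.
have xi1 a : order 1 (L T a) by apply: orderW (g2 a).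
have xiT2 n : comm N.+1 (iter n.+1 (xi (L T)) (xi (L T) F)).
  elim: n => [|n IH]; last by rewrite iterS; apply: xi_comm.
  rewrite /= -(subrK T (xi _ F)) xiD; apply: commD; first exact: xi_comm.
  by apply: comm_order; rewrite -addn1; apply: xi_order.
suff : comm N.+1 (subst h F - psi G).
  by move=> /(endo_comm e); rewrite (endoB _ _ e) K'.
apply: (@comm_trans _ _ _ _ (texp (L T) N.+1 F)).
  by apply: comm_order; apply: subst_exp_arrow.
rewrite GE !opprD !addrA; apply: commB; last first.
  exact: comm_commutators.
have -> : texp (L T) N.+1 F = F + xi (L T) F +
    \sum_(0 <= n < N.-1) dpow (L T) n.+2 F.
  case: N rN {TN xiT2 h chiG} => // -[|N] // _.
  rewrite /texp [LHS]big_nat_recl // [X in _ + X = _]big_nat_recl // dpow0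
    addrA.
  by have := xi_dpow (L T) 0 F; rewrite dpow0 scale1r => ->.
rewrite -(addrA F) [F + (_ + _)]addrC addrK addrAC.
apply: commD; first exact: xiT.
apply: comm_sum => n _; rewrite /dpow iterSr.
exact/commZ/xiT2.
Qed.

Lemma jet_reach chi G : analytic_auto chi -> comm r.+2 (chi F - G) -> forall k,
  exists2 chi', analytic_auto chi' & comm (k + r.+2) (chi' F - G).
Proof.
move=> chiA chiG; elim=> [|k [chi' chiA' chiG']]; first by exists chi.
by apply: jet_step chiA' chiG'; rewrite leq_addl.
Qed.

Hypothesis Fa : is_analytic F.

Lemma radius_choice (A B c : R) : 0 <= A -> 0 < B -> 0 <= c -> exists rho,
  [/\ 0 < rho, rho <= B, rho <= 1 & c * A * rho <= 1].
Proof.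
move=> A0 B0 c0'; have cA0 : 0 <= c * A by rewrite mulr_ge0.
have d0 : 0 < 1 + B^-1 + c * A by rewrite !ltr_wpDr ?invr_ge0 // ltW.
exists (1 + B^-1 + c * A)^-1; split.
- by rewrite invr_gt0.
- rewrite -[leRHS]invrK lef_pV2 ?posrE ?invr_gt0 //.
  by rewrite addrAC lerDr addr_ge0.
- by rewrite invf_le1 // -addrA lerDl addr_ge0 // invr_ge0 ltW.
- by rewrite ler_pdivrMr // mul1r lerDr addr_ge0 // invr_ge0 ltW.
Qed.

(* A fixed point of [g |-> L (H - remainder g F)]: doubling the order of H lets
   this map contract adically and, at a small radius rho, preserve the ball of
   radius [rho ^+ r.+3]. *)
Lemma exact_solution H : is_analytic H -> order (r.+2).*2 H ->
  exists g, [/\ forall a, is_analytic (g a), forall a, order 2 (g a) &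
    forall n, comm n (subst g F - F - H)].
Proof.
move=> Ha HK; case: (LP) => c0_ge0 r0_gt0 LB Lo [Lc Lb].
(* The order 2(r+2) of H minus the r lost by L. A gain of s in the remainder then exceeds the loss
   r, so the map contracts. *)
pose s := r.+4.
have sK : (s <= (r.+2).*2 - r)%N by rewrite /s -addnn; lia.
have epsK : (2 + (r.+2).*2 = r.+3 * 2)%N by rewrite -!addnn; lia.
have rK : (r + r.+3 = (r.+2).*2.-1)%N by rewrite -addnn; lia.
pose T g a := L (H - remainder g F) a.
have XK g : (forall a, order s (g a)) -> order (r.+2).*2 (H - remainder g F).
  move=> gs; apply: orderB => //; apply: orderW (remainder_order _ _ gs) => //.
  by rewrite /s -addnn; lia.
have [|g g' d gs gs' gg' a|g [gs gE gl]] := @adic_fixpoint R Q T s.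
- move=> g gs a; exact: orderW sK (Lo _ _ a (XK g gs)).
- rewrite /T -LB; have -> : H - remainder g F - (H - remainder g' F) =
      - (remainder g F - remainder g' F).
    by rewrite !opprB addrC addrA subrK.
  apply: orderW (Lo _ _ a (orderN (remainder_contract _ gs gs' gg' F))) => //.
  by rewrite /s; lia.
have g2 a : order 2 (g a) by apply: orderW (gs a).
exists g; split=> // [a|n]; last first.
  have -> : subst g F - F - H = xi g F - (H - remainder g F).
    by rewrite /remainder opprB addrA [xi _ _ + _]addrC subrK.
  rewrite [xi g F](_ : _ = xi (L (H - remainder g F)) F); last first.
    by congr (xi _ F); apply/funext => a; rewrite {1}gE.
  apply: xi_L; apply: orderW (XK _ gs); rewrite -addnn; lia.
have [rF [BF [rF0 BF0 FB]]] := analytic_wbounded Fa.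
have [rH [BH [rH0 BH0 HB]]] := analytic_wbounded Ha.
(* Both H and the remainder will be bounded by a multiple of rho^(2r+4); A is the sum of the two
   factors. *)
pose A := BF + BH / rH ^+ (r.+2).*2.
have A0 : 0 <= A by rewrite addr_ge0 // divr_ge0 // exprn_ge0 // ltW.
have m0 : 0 < Num.min r0 (Num.min rH (rF / 2)) by rewrite !lt_min r0_gt0 rH0
  divr_gt0.
have [rho [rho0 rhom rho1 cA]] := radius_choice A0 m0 c0_ge0.
move: rhom; rewrite !le_min => /and3P[rho_r0 rho_rH rho_rF].
have rho0' := ltW rho0; pose eps := rho ^+ r.+3.
have eps0 : 0 <= eps by rewrite exprn_ge0.
have eps_rho : eps <= rho by rewrite /eps exprS ler_piMr // exprn_ile1.
have rho_pow0 : 0 < rho ^+ r by rewrite exprn_gt0.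
move=> {LB Lo gE g2}; apply: (@wbounded_analytic _ _ _ rho eps) => //.
have Ts k : forall b, order s (iter k T (fun=> 0) b).
  elim: k => [|k IH] b; first exact: order_zero.
  rewrite iterS /T; case: LP => _ _ _ Lo _.
  apply: (@orderW _ _ ((r.+2).*2 - r)); first exact: sK.
  exact/Lo/XK.
apply: (wbounded_limit rho0' (fun k => gl k a)) => k.
elim: k a => [|k IH] a n; first by rewrite wnorm0.
rewrite [iter _ _ _]/=; set g' := iter k T _ in IH *; have gs' := Ts k.
have g1 b : order 1 (g' b) by apply: orderW (gs' b).
rewrite -(ler_pM2l rho_pow0); apply: le_trans (Lb _ _ _ _ rho0 rho_r0) _.
set m := (n + r)%N.
have HX : wnorm rho m H <= rho ^+ (r.+2).*2 * (BH / rH ^+ (r.+2).*2).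
  apply: le_trans (wbounded_scale rho0' rH0 rho_rH HK HB m) _.
  by rewrite expr_div_n mulrAC mulrA.
(* For eps = rho^(r+3), the quadratic estimate gives (eps / rho)^2 = rho^(2r+4), the same power as
   for H. *)
have RX : wnorm rho m (remainder g' F) <= rho ^+ (r.+2).*2 * BF.
  have rho2 : 0 < rho ^+ 2 by rewrite exprn_gt0.
  rewrite -(ler_pM2l rho2); apply: le_trans (wnorm_remainder rho0 eps0 g1 IH
    eps_rho _ _) _.
  have -> : rho ^+ 2 * (rho ^+ (r.+2).*2 * BF) = eps ^+ 2 * BF.
    rewrite mulrA -exprD /eps -exprM; congr (_ ^+ _ * _).
    exact: epsK.
  rewrite ler_wpM2l ?exprn_ge0 //; apply: le_trans (wnorm_le _ _ _ _) (FB m).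
    by rewrite mulr_ge0.
  by rewrite mulrC -ler_pdivlMr.
have XX : wnorm rho m (H - remainder g' F) <= rho ^+ (r.+2).*2 * A.
  by apply: le_trans (wnormB _ _ _ rho0') _; rewrite mulrDr addrC lerD.
apply: le_trans (ler_wpM2l c0_ge0 XX) _.
(* Compared with rho^r eps = rho^(2r+3) there is one spare factor rho, chosen to absorb [c0 * A]. *)
have -> : c0 * (rho ^+ (r.+2).*2 * A) = rho ^+ (r.+2).*2.-1 * (c0 * A * rho).
  by rewrite -[(r.+2).*2 in LHS]prednK ?double_gt0 // exprSr; ring.
have -> : rho ^+ r * eps = rho ^+ (r.+2).*2.-1.
  by rewrite /eps -exprD rK.
by rewrite ler_piMr // exprn_ge0.
Qed.

Lemma analytic_reach G : is_analytic G -> comm r.+2 (F - G) ->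
  exists2 chi, analytic_auto chi & forall n, comm n (chi F - G).
Proof.
move=> Ga FG.
have [chi chiA chiG] := jet_reach (analytic_auto_id R Q) FG r.+2.
have [psi [[e _] [e' psia] K K']] := chiA.
have : comm (r.+2).*2 (psi (G - chi F)).
  by rewrite -addnn; apply: endo_comm => //; apply: comm_sym.
rewrite (endoB _ _ e') K => -[c [t ->] ct].
(* The commutators found are those of formal series. Truncating their factors alters them only in
   order 2(r+2) and leaves an analytic right-hand side. *)
pose tr : S -> S := trunc (r.+2).*2.
pose c' := \sum_(gh <- t) (tr gh.1 * tr gh.2 - tr gh.2 * tr gh.1).
have tra f : is_analytic (tr f) by apply: trunc_analytic.
have c'a : is_analytic c'.
  rewrite /c'; elim: t {ct c'} => [|gh t IH].
    by rewrite big_nil; apply: analytic0.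
  rewrite big_cons; apply: analyticD => //.
  by apply: analyticB; apply: analyticM.
have c'c n : comm n c' by apply: comm_sum => gh _; apply: comm_bracket.
have [g [ga g2 gP]] : exists g, [/\ forall a, is_analytic (g a), forall a,
  order 2 (g a) &
    forall n, comm n (subst g F - F - (psi G - F - c'))].
  apply: exact_solution; first by apply: analyticB => //;
    apply: analyticB => //; apply: psia.
  have trM f h : order (r.+2).*2 (f * h - tr f * tr h).
    apply: (@order_trans _ _ _ (tr f * h)).
      rewrite -mulrBl; apply: orderMr; exact: trunc_mod.
    rewrite -mulrBr; apply: orderMl; exact: trunc_mod.
  apply: (order_trans ct); rewrite -sumrB; apply: order_sum => gh _.
  by rewrite opprD addrACA -opprD; apply: orderB.
exists (chi \o subst g).
  by apply: analytic_auto_comp => //; apply: subst_auto.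
move=> n; suff : comm n (subst g F - psi G).
  by move=> /(endo_comm e); rewrite (endoB _ _ e) K'.
rewrite -(subrK c' (psi G)) -[psi G - c'](subrK F) opprD opprD addrA addrA.
apply: commB => //.
have := gP n; rewrite [psi G - F - c']addrAC.
by rewrite [_ - F - _]addrAC.
Qed.

End Determinacy.

(** * Translation to potentials, jets and ideal powers *)

Section Potentials.
Variables (R : realType) (Q : quiver).
Notation S := (series R Q).
Implicit Types (f h : S) (n : nat) (Phi Psi : potential R Q).

Lemma order_ideal_pow n f : order n f -> ideal_pow (@formal_max R Q) n f.
Proof.
elim: n f => // n IH f fn /=.
exists [seq (ar R a, der a f) | a <- enum (arrow Q)].
  move=> _ /mapP[a _ ->] /=; split; last by apply: IH; exact: order_der fn.
  move=> p p0; rewrite -coefP (@order_ar R Q a) //.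
  by move: p0; rewrite /plength => ->.
by rewrite big_map big_enum /= -(order_rder fn).
Qed.

Lemma ideal_pow_order n (f : analytic R Q) :
  ideal_pow (@analytic_max R Q) n f -> order n (analytic_val f).
Proof.
elim: n f => [|n IH] f /=; first by move=> _; apply: order0.
move=> [s sI ->]; rewrite analytic_val_sum big_seq;
  apply: order_sum => gh /sI[g1 hn].
rewrite -add1n; apply: (@orderM _ _ 1 n (analytic_val gh.1)); last exact: IH.
apply: order1P => x; rewrite /c0 coef_path /=; exact: g1.
Qed.

Lemma word_ideal_pow (s : seq (arrow Q)) : exists2 f : analytic R Q,
  ideal_pow (@analytic_max R Q) (size s) f & analytic_val f = word R s.
Proof.
elim: s => [|a s [f fs fE]]; first by exists 1.
exists (path_series R (arrow_path a) * f); last by rewrite /= -fE.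
exists [:: (path_series R (arrow_path a), f)]; last by rewrite big_seq1.
move=> gh; rewrite inE => /eqP -> /=; split=> // p p0.
by rewrite -coefP (@order_ar R Q a) //; move: p0; rewrite /plength => ->.
Qed.

Lemma comm_cyc (f h : analytic R Q) :
  (forall n, comm n (analytic_val f - analytic_val h)) -> cyc f = cyc h.
Proof.
move=> fh; apply/cyc_eq => n; have [c cc fc] := fh n.
by exists c => //; apply: order_ideal_pow.
Qed.

Lemma auto_right_equivalent chi Phi Psi : analytic_auto chi ->
  (forall n, comm n (chi (analytic_val (representative Phi)) -
     analytic_val (representative Psi))) ->
  right_equivalent Phi Psi.
Proof.
move=> [psi [[e chia] [e' psia] K K']] chiP.
have aP (x : S -> S) (xa : forall f, is_analytic f -> is_analytic (x f))
    (f : analytic R Q) : x f \in @analytic_pred R Q.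
  by apply/asboolP/xa/analytic_valP.
pose phi (f : analytic R Q) := Analytic (aP chi chia f).
pose phi' (f : analytic R Q) := Analytic (aP psi psia f).
exists phi; last first.
  by rewrite -[RHS]representativeK; apply: comm_cyc.
split.
- move=> c f h; apply: val_inj; case: (e) => Lin _ _ _.
  rewrite /= -analytic_valZ; exact: Lin.
- split; first by apply: val_inj; apply: (endo1 e).
  by move=> f h; apply: val_inj; case: (e) => _ M _ _; apply: M.
- exists phi' => f; apply: val_inj; [exact: K|exact: K'].
by move=> x; apply: val_inj; case: (e) => _ _ E _; apply: E.
Qed.

(** Equal (r+1)-jets mean a difference of order r+2 up to commutators; after the loss of r in L the
    arrows move by series of order 2, as the exponentials require. *)
Lemma words_determined r Phi :
  (forall t, size t = r -> is_jac (representative Phi) (word R t)) ->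
  determined r.+1 Phi.
Proof.
move=> Jr Psi /jet_eq[g [t ->] gr]; have [L [c [rho LP]]] := jacobi_solution Jr.
have PhiPsi : comm r.+2 (analytic_val (representative Phi) -
    analytic_val (representative Psi)).
  apply: comm_sym.
  exists (\sum_(gh <- t) (analytic_val gh.1 * analytic_val gh.2 -
    analytic_val gh.2 * analytic_val gh.1)).
    by exists [seq (analytic_val gh.1, analytic_val gh.2) | gh <- t];
      rewrite big_map.
  have := ideal_pow_order gr; rewrite !analytic_valB analytic_val_sum.
  by under eq_bigr do rewrite analytic_valB.
have [chi chiA chiP] := analytic_reach LP (analytic_valP _) (analytic_valP _)
  PhiPsi.
exact: auto_right_equivalent chiA chiP.
Qed.

End Potentials.

Theorem theorem4p4 (R : realType) (Q : quiver) (Phi : potential R Q) :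
  (jacobi_finite Phi -> finitely_determined Phi) /\
  (forall r : nat,
     (forall f : analytic R Q,
        ideal_pow (@analytic_max R Q) r f -> jacobi_ideal Phi f) ->
     determined r.+1 Phi).
Proof.
split=> [/jacobi_finite_words[k Jk]|r Jr]; first by exists k.+1;
  apply: words_determined.
apply: words_determined => t tr; have [f fr <-] := word_ideal_pow R t.
by apply/jacobi_ideal_is_jac/Jr; rewrite -tr.
Qed.
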